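(* Let $k = \mathbb Z/(2)$, $U = k[X,Y,Z]$ the polynomial ring, $R = U/(XY(X+Y))$, let $x,y,z$ be the images of $X,Y,Z$ in $R$, and $A = k[x,y]\subseteq R$. Then: (1) $\overline R = R/xR\times R/yR\times R/(x+y)R$ and $\overline A = A/xA\times A/yA\times A/(x+y)A$ (with $R$, resp. $A$, embedded diagonally; via the canonical injections $A/xA\to R/xR$ etc., regard $\overline A\subseteq\overline R$). (2) With $\mathfrak m = (x,y)A$ and $\rho = (\overline y, 0, 0)\in\overline A$, the strict closure $A^*$ of $A$ in $\overline A$ is $A^* = A + \mathfrak m\overline A = A + k\rho$, and $\ell_A(A^*/A) = 1$. (3) $A = A^a \subsetneq A^*$. (4) $R^* = A^*[z] = R + k[z]\cdot\rho$ and $R^a = R + k[z]\cdot z(1+z)\rho$; hence $R\subsetneq R^a\subsetneq R^*$. Here $R^*$ is the strict closure of $R$ in $\overline R$, and $A^a$, $R^a$ are weakly Arf closures.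
   Context: For a commutative ring $B$, $W(B)$ is the set of non-zerodivisors, $\mathrm{Q}(B)$ the total ring of fractions, $\overline B$ the integral closure of $B$ in $\mathrm{Q}(B)$; $\overline{(\cdot)}$ on components denotes images in the corresponding quotient ring. The strict closure of $B$ in $C\supseteq B$ is $\{\alpha \in C \mid \alpha\otimes 1 = 1\otimes \alpha \text{ in } C\otimes_B C\}$. $B$ is weakly Arf if for all $a,b,c\in B$ with $a\in W(B)$ and $\frac ba,\frac ca\in\overline B$ one has $\frac{bc}{a}\in B$. Weakly Arf closure: $B_1 = B[\frac{bc}{a}\mid a\in W(B),\ b,c\in B,\ \frac ba,\frac ca\in\overline B]$, $B_0=B$, $B_n=(B_{n-1})_1$, and $B^a=\bigcup_n B_n$ (the smallest weakly Arf ring between $B$ and $\overline B$). $\ell_A$ denotes length as $A$-module. *)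

(* Defs.v *)
From HB Require Import structures.
From mathcomp Require Import all_boot all_order all_algebra.
From mathcomp Require Import mpoly.
Set Implicit Arguments.
Unset Strict Implicit.
Unset Printing Implicit Defensive.
Import Order.TTheory GRing.Theory Num.Theory.
Local Open Scope ring_scope.

(* General notions.  All rings considered are subrings (predicates) of one  *)
(* ambient commutative ring Q with computable inverses (in the theorem, Q   *)
(* is the total ring of fractions of R).                                     *)

Definition seteq (Q : Type) (P1 P2 : Q -> Prop) := forall q, P1 q <-> P2 q.
Definition strict_sub (Q : Type) (P1 P2 : Q -> Prop) :=
  (forall q, P1 q -> P2 q) /\ exists q, P2 q /\ ~ P1 q.

Definition subring (Q : comUnitRingType) (B : Q -> Prop) :=
  [/\ B 1, (forall a b, B a -> B b -> B (a - b)) &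
      (forall a b, B a -> B b -> B (a * b))].

Definition nzd (Q : comUnitRingType) (B : Q -> Prop) (s : Q) :=
  B s /\ forall b, B b -> s * b = 0 -> b = 0.

Definition total_frac (Q : comUnitRingType) (B : Q -> Prop) :=
  (forall s, nzd B s -> s \is a GRing.unit) /\
  (forall q, exists a s, [/\ B a, nzd B s & q = a / s]).

Definition frac (Q : comUnitRingType) (B : Q -> Prop) (q : Q) :=
  exists a s, [/\ B a, nzd B s & q = a / s].

Definition integral_over (Q : comUnitRingType) (B : Q -> Prop) (q : Q) :=
  exists p : {poly Q}, [/\ p \is monic, (forall i, B p`_i) & root p q].

Definition intclos (Q : comUnitRingType) (B : Q -> Prop) (q : Q) :=
  frac B q /\ integral_over B q.

Definition adjoin (Q : comUnitRingType) (B S : Q -> Prop) (q : Q) :=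
  forall T : Q -> Prop, subring T -> (forall b, B b -> T b) ->
    (forall s, S s -> T s) -> T q.

Definition arf_step (Q : comUnitRingType) (B : Q -> Prop) : Q -> Prop :=
  adjoin B (fun q => exists a b c, [/\ nzd B a, B b, B c &
     [/\ intclos B (b / a), intclos B (c / a) & q = b * c / a]]).

Definition arf_iter (Q : comUnitRingType) (n : nat) (B : Q -> Prop) :=
  iter n (@arf_step Q) B.

Definition arf_closure (Q : comUnitRingType) (B : Q -> Prop) (q : Q) :=
  exists n, arf_iter n B q.

(* Strict closure of B in C:  alpha in C with alpha (x) 1 = 1 (x) alpha in
   C (x)_B C.  Equality in C (x)_B C is expressed through the universal
   property of the tensor product: two elements of C (x)_B C are equal iff
   they have the same image under every B-balanced biadditive map
   C x C -> M into an abelian group M. *)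
Definition balanced (Q : comUnitRingType) (B C : Q -> Prop) (M : zmodType)
    (f : Q -> Q -> M) :=
  [/\ (forall c c' d, C c -> C c' -> C d -> f (c + c') d = f c d + f c' d),
      (forall c d d', C c -> C d -> C d' -> f c (d + d') = f c d + f c d') &
      (forall b c d, B b -> C c -> C d -> f (c * b) d = f c (b * d))].

Definition strict_closure (Q : comUnitRingType) (B C : Q -> Prop) (q : Q) :=
  C q /\ forall (M : zmodType) (f : Q -> Q -> M), balanced B C f -> f q 1 = f 1 q.

(* B-submodules of Q, chains, and length of M/N as B-module
   (supremum of lengths of strict chains of submodules of M/N, i.e. of
   B-submodules between N and M). *)
Definition submod (Q : comUnitRingType) (B N : Q -> Prop) :=
  [/\ N 0, (forall u v, N u -> N v -> N (u + v)) &
      (forall b u, B b -> N u -> N (b * u))].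

Definition chain (Q : comUnitRingType) (B N M : Q -> Prop) (n : nat) :=
  exists L : nat -> Q -> Prop,
    [/\ seteq (L 0%N) N, seteq (L n) M,
        (forall i, (i <= n)%N -> submod B (L i)) &
        (forall i, (i < n)%N -> strict_sub (L i) (L i.+1))].

Definition length_quot (Q : comUnitRingType) (B M N : Q -> Prop) (n : nat) :=
  chain B N M n /\ forall m, chain B N M m -> (m <= n)%N.

Definition iX : 'I_3 := @Ordinal 3 0 isT.
Definition iY : 'I_3 := @Ordinal 3 1 isT.
Definition iZ : 'I_3 := @Ordinal 3 2 isT.

Definition fXYXY : {mpoly 'F_2[3]} := 'X_iX * 'X_iY * ('X_iX + 'X_iY).

Definition incl2 (p : {mpoly 'F_2[2]}) : {mpoly 'F_2[3]} :=
  mmap (fun c : 'F_2 => c%:MP) (fun i : 'I_2 => 'X_(widen_ord (isT : (2 <= 3)%N) i)) p.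

Section Concrete.
Variables (Q : comUnitRingType) (pi : {rmorphism {mpoly 'F_2[3]} -> Q}).

Definition xx : Q := pi 'X_iX.
Definition yy : Q := pi 'X_iY.
Definition zz : Q := pi 'X_iZ.
Definition kc (c : 'F_2) : Q := pi c%:MP.
Definition Rr (q : Q) := exists p, q = pi p.
Definition Ar (q : Q) := exists p : {mpoly 'F_2[2]}, q = pi (incl2 p).
Definition kz (q : Q) :=
  exists g : {poly 'F_2}, q = pi ((map_poly (fun c : 'F_2 => c%:MP) g).['X_iZ]).
End Concrete.

(* Main.v *)
Require Import Defs.
From HB Require Import structures.
From mathcomp Require Import all_boot all_order all_algebra.
From mathcomp Require Import mpoly.
From mathcomp Require Import ring zify.
From Stdlib Require Import ClassicalEpsilon FunctionalExtensionality PropExtensionality.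
Set Implicit Arguments.
Unset Strict Implicit.
Unset Printing Implicit Defensive.
Import GRing.Theory.
Local Open Scope ring_scope.

(* Setting t for the surviving variable, R embeds in D^3 with D = k[z][t], by
   x = (0, t, t), y = (t, 0, t); its image consists of the triples f whose
   values f_i(0) in k[z] agree and whose slopes satisfy
   f_1'(0) + f_2'(0) - f_3'(0) = 0.  Since t^2 D^3 lies in R and D is completely
   integrally closed, the integral closure is D^3.  The strict closure keeps
   only the condition on the f_i(0).  The ring where the combination of slopes
   lies in an ideal I of k[z] is weakly Arf as soon as a fraction whose
   denominator a vanishes at t = 0 behaves well, a condition on the slopes of a
   that holds over F_2, hence for k itself with I = 0 (the ring A) and, by
   evaluation at z = 0 and z = 1, for k[z] with I = (z(1 + z)). *)

(** * Complete integral closure of polynomial rings *)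

(** The ideal (z(1 + z)) arises because k has two elements. Over F_2 a relation a_1 + a_2 = a_3
    between slopes leaves no nonzero slope or exactly two, and with two the condition on u only
    compares two of its values, which is stable under products. Over k[z] the slopes 1, z, 1 + z are
    all nonzero and break this; one of them vanishes exactly at z = 0 or z = 1, whence the
    obstruction z(1 + z) rho. The iterates of the weakly Arf construction are never computed: each
    lies between the model with I = 0 and the ring of all triples, and every such ring has all
    triples as its integral closure. Since Q is known only as a total ring of fractions, triples are
    read inside Q through an injective morphism E, and the same lemmas serve A and R. *)

(* The hypothesis says d (a / s)^n lies in K for all n; it is inherited by
   polynomial rings through leading coefficients, with no fraction field. *)
Definition almost_integrally_closed (K : idomainType) :=
  forall a s d : K, s != 0 -> d != 0 ->
    (forall n, exists c, d * a ^+ n = c * s ^+ n) -> exists c, a = c * s.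

Lemma field_almost_integrally_closed (F : fieldType) :
  almost_integrally_closed F.
Proof. by move=> a s d s0 _ _; exists (a / s); rewrite divfK. Qed.

(** In the binomial expansion the term in a^(n-i) s^i already carries s^i and receives s^(n-i) from
    the hypothesis. This permits division with remainder below. *)
Lemma almost_integral_sub (K : idomainType) (a s d c : K) :
  (forall n, exists e, d * a ^+ n = e * s ^+ n) ->
  forall n, exists e, d * (a - c * s) ^+ n = e * s ^+ n.
Proof.
move=> H n; rewrite exprBn.
apply: (big_ind (fun q => exists e, d * q = e * s ^+ n)).
- by exists 0; rewrite mulr0 mul0r.
- by move=> q q' [e He] [e' He']; exists (e + e'); rewrite mulrDr He He' mulrDl.
- move=> i _; have [e He] := H (n - i)%N.
  exists ((e * (-1) ^+ i * c ^+ i) *+ 'C(n, i)).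
  rewrite mulrnAr mulrnAl; congr (_ *+ _).
  rewrite exprMn; have -> : s ^+ n = s ^+ (n - i) * s ^+ i.
    by rewrite -exprD subnK // -ltnS.
  transitivity (d * a ^+ (n - i) * ((-1) ^+ i * c ^+ i * s ^+ i)); first by ring.
  by rewrite He; ring.
Qed.

(** Euclidean descent on the degree of a: the leading coefficients inherit the hypothesis over [K],
    so the leading term of a is cancelled by a multiple of s, until a has smaller degree than s and
    must vanish. *)
Lemma poly_almost_integrally_closed (K : idomainType) :
  almost_integrally_closed K -> almost_integrally_closed {poly K}.
Proof.
move=> hK a s d s0 d0.
have [m] := ubnP (size a); elim: m a => // m IHm a lt_am H.
have [->|a0] := eqVneq a 0; first by exists 0; rewrite mul0r.
have [lt_as|le_sa] := ltnP (size a) (size s).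
  (* The exponent [size d] exceeds deg d, hence n (deg s - deg a) > deg d, and no nonzero c can
     balance the degrees. *)
  have [c Hc] := H (size d).
  have da0 : d * a ^+ size d != 0 by rewrite mulf_neq0 ?expf_neq0.
  have c0 : c != 0 by apply/eqP=> c0; rewrite Hc c0 mul0r eqxx in da0.
  have szX (p : {poly K}) n : p != 0 -> size (p ^+ n) = ((size p).-1 * n).+1.
    by move=> p0; rewrite -size_exp prednK // size_poly_gt0 expf_neq0.
  have le_as : ((size a).-1.+1 * size d <= (size s).-1 * size d)%N.
    by rewrite leq_mul2r; apply/orP; right; move: a0; rewrite -size_poly_gt0; lia.
  have := congr1 (fun p : {poly K} => size p) Hc.
  rewrite !size_mul ?expf_neq0 // !szX // !addnS /= => E.
  move: le_as E c0; rewrite mulSn -size_poly_gt0; move: (_ * _)%N (_ * _)%N => u v.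
  move=> le_uv E c0.
  have := leq_trans (leq_add c0 (leqnn u)) (leq_trans (eq_leq (esym E)) le_uv).
  by rewrite ltnn.
have [l Hl] : exists l, lead_coef a = l * lead_coef s.
  apply: (hK _ _ (lead_coef d)); rewrite ?lead_coef_eq0 // => n.
  have [c Hc] := H n; exists (lead_coef c).
  by rewrite -!lead_coef_exp -!lead_coefM Hc.
pose b := (l *: 'X^(size a - size s)) : {poly K}.
have lt_ba : (size (a - b * s)%R < size a)%N.
  move: a0; rewrite -size_poly_gt0 => a0; move: (s0); rewrite -size_poly_gt0 => s1.
  rewrite -(prednK a0) ltnS; apply/leq_sizeP => j lej.
  have [k ek] : exists k, (size s + k = size a)%N by exists (size a - size s)%N; rewrite subnKC.
  have ek' : (size a - size s = k)%N by rewrite -ek addKn.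
  rewrite coefB /b -scalerAl coefZ coefXnM ek'.
  move: lej; rewrite leq_eqVlt => /orP[/eqP <-|ltj].
    have -> : (size a).-1 = ((size s).-1 + k)%N by rewrite -ek -[in LHS](prednK s1).
    rewrite ltnNge leq_addl /= addnK.
    have -> : a`_((size s).-1 + k) = lead_coef a.
      by rewrite lead_coefE -ek -[in RHS](prednK s1).
    by rewrite Hl subrr.
  have le_aj : (size a <= j)%N by rewrite -(prednK a0).
  rewrite ltnNge (leq_trans _ le_aj) -?ek ?leq_addl //=.
  rewrite !nth_default ?mulr0 ?subr0 // -(leq_add2r k) subnK ?ek //.
  by rewrite (leq_trans _ le_aj) // -ek leq_addl.
have [||c Hc] := IHm (a - b * s); first by rewrite (leq_trans lt_ba).
  exact: almost_integral_sub.
by exists (c + b); rewrite mulrDl -Hc subrK.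
Qed.

(** * Triples of polynomials *)

Definition triple (K : idomainType) := ({poly K} * {poly K} * {poly K})%type.

Definition diag0 (K : idomainType) (f : triple K) :=
  f.1.1`_0 = f.1.2`_0 /\ f.1.1`_0 = f.2`_0.

(* The sign makes the two generators (0, 'X, 'X) and ('X, 0, 'X) have slope 0
   in every characteristic. *)
Definition slope (K : idomainType) (f : triple K) : K :=
  f.1.1`_1 + f.1.2`_1 - f.2`_1.

Definition diagC (K : idomainType) (p : {poly K}) : triple K := (p, p, p).

Definition is_ideal (K : idomainType) (I : K -> Prop) :=
  [/\ I 0, (forall a b, I a -> I b -> I (a + b)) &
      (forall c a, I a -> I (c * a))].

Section Triples.
Variable K : idomainType.
Implicit Types (f g : triple K) (I : K -> Prop).

Lemma triple_eq f g : f.1.1 = g.1.1 -> f.1.2 = g.1.2 -> f.2 = g.2 -> f = g.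
Proof. by case: f g => [[? ?] ?] [[? ?] ?] /= -> -> ->. Qed.

Lemma tripleX f n : f ^+ n = (f.1.1 ^+ n, f.1.2 ^+ n, f.2 ^+ n).
Proof. by elim: n => // n IHn; rewrite !exprS IHn. Qed.

Lemma coef1M (p q : {poly K}) : (p * q)`_1 = p`_0 * q`_1 + p`_1 * q`_0.
Proof. by rewrite coefM !big_ord_recl big_ord0 addr0. Qed.

Lemma diag0B f g : diag0 f -> diag0 g -> diag0 (f - g).
Proof. by case=> h1 h2 [h3 h4]; split; rewrite /= !coefB; congr (_ - _). Qed.

Lemma diag0D f g : diag0 f -> diag0 g -> diag0 (f + g).
Proof. by case=> h1 h2 [h3 h4]; split; rewrite /= !coefD; congr (_ + _). Qed.

Lemma diag0M f g : diag0 f -> diag0 g -> diag0 (f * g).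
Proof. by case=> h1 h2 [h3 h4]; split; rewrite /= !coef0M; congr (_ * _). Qed.

Lemma slopeB f g : slope (f - g) = slope f - slope g.
Proof. by rewrite /slope /= !coefB; ring. Qed.

Lemma slopeD f g : slope (f + g) = slope f + slope g.
Proof. by rewrite /slope /= !coefD; ring. Qed.

(** On triples with a common value at t = 0 the slope is a derivation over that evaluation; this is
    why an ideal of slopes cuts out a subring. *)
Lemma slopeM f g : diag0 f -> diag0 g ->
  slope (f * g) = f.1.1`_0 * slope g + g.1.1`_0 * slope f.
Proof.
by case=> h1 h2 [h3 h4]; rewrite /slope /= !coef1M -h1 -h2 -h3 -h4; ring.
Qed.

Lemma slope_diagC_polyC (c : K) : slope (diagC c%:P) = 0.
Proof. by rewrite /slope /= !coefC /= !addr0 subr0. Qed.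

Lemma diag0_X2 f : diag0 (diagC 'X^2 * f).
Proof. by split; rewrite /= !coefXnM. Qed.

Lemma slope_X2 f : slope (diagC 'X^2 * f) = 0.
Proof. by rewrite /slope /= !coefXnM /= addr0 subr0. Qed.

End Triples.

(** * Subrings of the ambient ring *)

Section SubringLemmas.
Variables (Q : comUnitRingType) (T : Q -> Prop).
Hypothesis HT : subring T.

Lemma subring1 : T 1. Proof. by case: HT. Qed.
Lemma subringB a b : T a -> T b -> T (a - b). Proof. by case: HT => _ H _; exact: H. Qed.
Lemma subringM a b : T a -> T b -> T (a * b). Proof. by case: HT => _ _ H; exact: H. Qed.
Lemma subring0 : T 0. Proof. by rewrite -(subrr 1); apply: subringB; apply: subring1. Qed.
Lemma subringD a b : T a -> T b -> T (a + b).
Proof.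
by move=> Ta Tb; rewrite -[b]opprK -[- b]sub0r; do 2!apply: subringB => //; exact: subring0.
Qed.
Lemma subringX a n : T a -> T (a ^+ n).
Proof.
move=> Ta; elim: n => [|n IHn]; first by rewrite expr0; exact: subring1.
by rewrite exprS; apply: subringM.
Qed.

Lemma subring_sum (J : Type) (r : seq J) (P : pred J) (F : J -> Q) :
  (forall i, P i -> T (F i)) -> T (\sum_(i <- r | P i) F i).
Proof. by move=> H; apply: big_ind => //; [exact: subring0 | exact: subringD]. Qed.

Lemma subring_coefM (p q : {poly Q}) :
  (forall i, T p`_i) -> (forall i, T q`_i) -> forall i, T (p * q)`_i.
Proof.
by move=> Hp Hq i; rewrite coefM; apply: subring_sum => j _; apply: subringM.
Qed.

Lemma subring_coefXsubC (a : Q) : T a -> forall i, T ('X - a%:P)`_i.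
Proof.
move=> Ta i; rewrite coefB coefX coefC; apply: subringB; case: eqP => _ //.
- exact: subring1.
- exact: subring0.
- exact: subring0.
Qed.

End SubringLemmas.

(** * Integral, strict and weakly Arf closures of the model *)

Section Model.
Variables (K : idomainType) (Q : comUnitRingType).
Variable E : {rmorphism triple K -> Q}.
Hypothesis Einj : injective E.
Hypothesis Eunit : forall f : triple K,
  f.1.1 != 0 -> f.1.2 != 0 -> f.2 != 0 -> E f \is a GRing.unit.
Hypothesis hK : almost_integrally_closed {poly K}.

Definition model (I : K -> Prop) (q : Q) :=
  exists f, [/\ diag0 f, I (slope f) & q = E f].

Definition image (q : Q) := exists f, q = E f.

Definition zero_ideal (c : K) := c = 0.

Lemma image_subring : subring image.
Proof.
split; first by exists 1; rewrite rmorph1.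
- by move=> _ _ [f ->] [g ->]; exists (f - g); rewrite rmorphB.
- by move=> _ _ [f ->] [g ->]; exists (f * g); rewrite rmorphM.
Qed.

Lemma is_ideal_zero : is_ideal zero_ideal.
Proof.
split=> // [a b -> ->|c a ->]; first exact: addr0.
exact: mulr0.
Qed.

Lemma model_subring I : is_ideal I -> subring (model I).
Proof.
move=> [I0 ID IM]; have IN a : I a -> I (- a).
  by move=> Ia; rewrite -mulN1r; apply: IM.
split.
- exists (diagC 1); split; rewrite ?rmorph1 //.
  by rewrite slope_diagC_polyC.
- move=> _ _ [f [df If ->]] [g [dg Ig ->]]; exists (f - g).
  split; [exact: diag0B | | by rewrite rmorphB].
  by rewrite slopeB; apply: ID => //; apply: IN.
- move=> _ _ [f [df If ->]] [g [dg Ig ->]]; exists (f * g).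
  split; [exact: diag0M | | by rewrite rmorphM].
  by rewrite slopeM //; apply: ID; apply: IM.
Qed.

Lemma model_image I q : model I q -> image q.
Proof. by case=> f [_ _ ->]; exists f. Qed.

Lemma modelS I q : I 0 -> model zero_ideal q -> model I q.
Proof. by move=> I0 [f [df If ->]]; exists f; split; rewrite ?If. Qed.

Lemma model_X2 f : model zero_ideal (E (diagC 'X^2 * f)).
Proof.
by exists (diagC 'X^2 * f); split => //; [exact: diag0_X2 | exact: slope_X2].
Qed.

Section Intermediate.
Variable B : Q -> Prop.
Hypothesis lowB : forall q, model zero_ideal q -> B q.
Hypothesis uppB : forall q, B q -> image q.

(** Since t^2 g lies in B for every triple g, a non-zerodivisor of B kills no triple at all; testing
    it on the three idempotents shows that no component is zero. *)
Lemma nzd_image q : nzd B q ->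
  exists f : triple K, [/\ f.1.1 != 0, f.1.2 != 0, f.2 != 0 & q = E f].
Proof.
case=> /uppB [f ->] Hf; exists f.
have X2 (g : triple K) : f * g = 0 -> g = 0.
  move=> fg0; have /Hf H := lowB (model_X2 g).
  have {}H := H _; have : E (diagC 'X^2 * g) = E 0.
    by rewrite rmorph0; apply: H; rewrite -rmorphM mulrCA fg0 mulr0 rmorph0.
  move=> /Einj H'.
  have hX (p : {poly K}) : 'X^2 * p = 0 -> p = 0.
    by move/eqP; rewrite mulf_eq0 expf_eq0 polyX_eq0 /= => /eqP.
  apply: triple_eq; apply: hX.
  - exact: (congr1 (fun u : triple K => u.1.1) H').
  - exact: (congr1 (fun u : triple K => u.1.2) H').
  - exact: (congr1 (fun u : triple K => u.2) H').
have n1 : (1 : {poly K}) <> 0 by apply/eqP; exact: oner_neq0.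
split => //; apply/eqP => f0; apply: n1.
- have H : (1, 0, 0) = 0 :> triple K.
    by apply: X2; apply: triple_eq; rewrite /= ?mulr0 // f0 mul0r.
  exact: (congr1 (fun u : triple K => u.1.1) H).
- have H : (0, 1, 0) = 0 :> triple K.
    by apply: X2; apply: triple_eq; rewrite /= ?mulr0 // f0 mul0r.
  exact: (congr1 (fun u : triple K => u.1.2) H).
- have H : (0, 0, 1) = 0 :> triple K.
    by apply: X2; apply: triple_eq; rewrite /= ?mulr0 // f0 mul0r.
  exact: (congr1 (fun u : triple K => u.2) H).
Qed.

Lemma nzd_is_unit q : nzd B q -> q \is a GRing.unit.
Proof. by move=> /nzd_image [f [f1 f2 f3 ->]]; apply: Eunit. Qed.

(** With N the degree of the monic equation, E s ^+ N is a common denominator of all powers of q: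
    the equation, whose coefficients are triples, reduces each power beyond N to lower ones. *)
Lemma integral_denominator (a s : triple K) (q : Q) :
  integral_over B q -> E s * q = E a ->
  exists N, forall n, exists g, E s ^+ N * q ^+ n = E g.
Proof.
case=> p [mon_p cp rp] Eq; have iS := image_subring.
set N := (size p).-1.
have szp : size p = N.+1 by rewrite prednK // size_poly_gt0 monic_neq0.
have qN : q ^+ N = - \sum_(i < N) p`_i * q ^+ i.
  apply/eqP; rewrite -addr_eq0 addrC; apply/eqP.
  move/rootP: rp; rewrite horner_coef szp big_ord_recr /=.
  by have := monicP mon_p; rewrite lead_coefE -/N => ->; rewrite mul1r.
exists N => n; suff : image (E s ^+ N * q ^+ n) by [].
have [m] := ubnP n; elim: m n => // m IHm n lt_nm.
have [le_nN|lt_Nn] := leqP n N.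
  rewrite -(subnK le_nN) exprD -mulrA -exprMn Eq.
  by apply: subringM => //; apply: subringX => //; [exists s | exists a].
have le_Nn := ltnW lt_Nn.
rewrite -(subnK le_Nn) exprD qN mulrN mulrN mulr_sumr mulr_sumr -sub0r.
apply: subringB => //; first exact: subring0.
apply: subring_sum => // i _.
have -> : E s ^+ N * (q ^+ (n - N) * (p`_i * q ^+ i)) =
          p`_i * (E s ^+ N * q ^+ (n - N + i)) by rewrite exprD; ring.
apply: subringM => //; first exact: uppB.
apply: IHm; rewrite -ltnS; apply: leq_trans lt_nm; rewrite ltnS.
by rewrite -[X in (_ < X)%N](subnK le_Nn) ltn_add2l.
Qed.

(** A common denominator for all powers of a / s is what complete integral closedness needs in each
    component. Conversely a triple f is the fraction t^2 f / t^2 and is a root of an explicit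
    cubic. *)
Lemma intclos_image : seteq (intclos B) image.
Proof.
have iM := model_subring is_ideal_zero.
move=> q; split.
  case=> [[a [s [Ba nzs ->]]] qint].
  have us := nzd_is_unit nzs.
  have [fs [s1 s2 s3 Es]] := nzd_image nzs.
  have [fa Ea] := uppB Ba.
  have [|N HN] := @integral_denominator fa fs _ qint.
    by rewrite -Es -Ea mulrCA divrr // mulr1.
  have HN' n : exists g : triple K, fs ^+ N * fa ^+ n = g * fs ^+ n.
    have [g Hg] := HN n; exists g; apply: Einj.
    rewrite !rmorphM !rmorphXn -Hg /= -Es -Ea exprMn exprVn -!mulrA.
    by rewrite mulVr ?mulr1 // unitrX.
  have [|n|c1 H1] := hK s1 (d := fs.1.1 ^+ N) (a := fa.1.1).
  - by rewrite expf_neq0.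
  - have [g Hg] := HN' n; exists g.1.1.
    by move: (congr1 (fun u : triple K => u.1.1) Hg); rewrite !tripleX.
  have [|n|c2 H2] := hK s2 (d := fs.1.2 ^+ N) (a := fa.1.2).
  - by rewrite expf_neq0.
  - have [g Hg] := HN' n; exists g.1.2.
    by move: (congr1 (fun u : triple K => u.1.2) Hg); rewrite !tripleX.
  have [|n|c3 H3] := hK s3 (d := fs.2 ^+ N) (a := fa.2).
  - by rewrite expf_neq0.
  - have [g Hg] := HN' n; exists g.2.
    by move: (congr1 (fun u : triple K => u.2) Hg); rewrite !tripleX.
  exists (c1, c2, c3); apply: (canLR (mulrK us)).
  by rewrite Ea Es -rmorphM; congr (E _); apply: triple_eq.
case=> f ->; split.
  exists (E (diagC 'X^2 * f)), (E (diagC 'X^2 * 1)); split.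
  - exact: lowB (model_X2 _).
  - split; first exact: lowB (model_X2 _).
    rewrite mulr1 => b _ H.
    have u2 : E (diagC 'X^2) \is a GRing.unit.
      by apply: Eunit; rewrite /= expf_neq0 // polyX_eq0.
    by rewrite -[b](mulKr u2) H mulr0.
  - rewrite mulr1 rmorphM mulrAC divrr ?mul1r //.
    by apply: Eunit; rewrite /= expf_neq0 // polyX_eq0.
(* Each of [f1], [f2], [f3] has slope 0 and agrees with f in one component, a different one each
   time, so the product of the f - f_i is 0. *)
pose f1 : triple K := (f.1.1, (f.1.1`_0)%:P, f.1.1).
pose f2 : triple K := ((f.1.2`_0)%:P, f.1.2, f.1.2).
pose f3 : triple K := (f.2, (f.2`_0)%:P, f.2).
have m1 : model zero_ideal (E f1).
  by exists f1; split => //; rewrite /f1 /zero_ideal /diag0 /slope /= coefC ?addr0 ?subrr.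
have m2 : model zero_ideal (E f2).
  by exists f2; split => //; rewrite /f2 /zero_ideal /diag0 /slope /= !coefC ?add0r ?subrr.
have m3 : model zero_ideal (E f3).
  by exists f3; split => //; rewrite /f3 /zero_ideal /diag0 /slope /= coefC ?addr0 ?subrr.
exists (('X - (E f1)%:P) * ('X - (E f2)%:P) * ('X - (E f3)%:P)); split.
- by rewrite !monicMl ?monicXsubC.
- move=> i; apply: lowB; move: i.
  by apply: subring_coefM => //; [apply: subring_coefM => // |];
     apply: subring_coefXsubC.
- rewrite rootE !hornerM !hornerXsubC -!rmorphB -!rmorphM; apply/eqP.
  rewrite -(rmorph0 E); congr (E _).
  by apply: triple_eq; rewrite /= subrr ?mulr0 ?mul0r.
Qed.

End Intermediate.

(** A choice-made inverse of [E]. Outside the image its value is arbitrary, so additivity is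
    available only on the image. *)
Definition section (q : Q) : triple K :=
  epsilon (inhabits 0) (fun f => q = E f).

Lemma sectionK : cancel E section.
Proof.
move=> f; apply: Einj; symmetry.
exact: (epsilon_spec (inhabits 0) (fun g => E f = E g) (ex_intro _ f erefl)).
Qed.

Let intclos_model := intclos_image (fun q (h : model zero_ideal q) => h)
  (@model_image zero_ideal).

(* The balanced maps (c, d) |-> c_1(0) d_2(0) and c_1(0) d_3(0) detect the
   condition at t = 0; conversely the tensors e_1 (x) t e_3 and e_3 (x) t e_1
   vanish because t e_3 = x e_3 with x e_1 = 0, which gives
   rho (x) 1 = 1 (x) rho for rho = y e_1. *)
Lemma strict_closure_model :
  seteq (strict_closure (model zero_ideal) (intclos (model zero_ideal)))
        (model (fun _ => True)).
Proof.
move=> q; split.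
  case=> /intclos_model [f ->] Hf; exists f; split => //.
  pose phi (pr : triple K -> {poly K}) (c d : Q) : K :=
    (section c).1.1`_0 * (pr (section d))`_0.
  have secD (c c' : Q) : image c -> image c' ->
      section (c + c') = section c + section c'.
    by move=> [g ->] [g' ->]; rewrite -rmorphD !sectionK.
  split.
    have := Hf K (phi (fun u => u.1.2)); rewrite /phi -(rmorph1 E) !sectionK /=.
    rewrite !coef1 mulr1 mul1r; apply.
    split=> [c c' d /intclos_model hc /intclos_model hc' _
           | c d d' _ /intclos_model hd /intclos_model hd'
           | _ _ _ [b [[b12 b13] _ ->]] /intclos_model [g ->] /intclos_model [g' ->]].
    + by rewrite /phi secD //= coefD mulrDl.
    + by rewrite /phi secD //= coefD mulrDr.
    + by rewrite /phi -!rmorphM !sectionK /= !coef0M -b12 mulrA.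
  have := Hf K (phi (fun u => u.2)); rewrite /phi -(rmorph1 E) !sectionK /=.
  rewrite !coef1 mulr1 mul1r; apply.
  split=> [c c' d /intclos_model hc /intclos_model hc' _
         | c d d' _ /intclos_model hd /intclos_model hd'
         | _ _ _ [b [[b12 b13] _ ->]] /intclos_model [g ->] /intclos_model [g' ->]].
  + by rewrite /phi secD //= coefD mulrDl.
  + by rewrite /phi secD //= coefD mulrDr.
  + by rewrite /phi -!rmorphM !sectionK /= !coef0M -b13 mulrA.
case=> f [df _ ->]; split; first by apply/intclos_model; exists f.
move=> M phi [addl addr bal].
have iE (g : triple K) : intclos (model zero_ideal) (E g).
  by apply/intclos_model; exists g.
have i1 : intclos (model zero_ideal) 1 by rewrite -(rmorph1 E).
have phi0l d : intclos (model zero_ideal) d -> phi 0 d = 0.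
  move=> hd; have i0 := iE 0; rewrite rmorph0 in i0.
  by apply: (@addrI _ (phi 0 d)); rewrite -addl // !addr0.
have phi0r d : intclos (model zero_ideal) d -> phi d 0 = 0.
  move=> hd; have i0 := iE 0; rewrite rmorph0 in i0.
  by apply: (@addrI _ (phi d 0)); rewrite -addr // !addr0.
(* Scaling by the slope of f makes [e1 * y] equal to slope(f) rho, the part of f that leaves the
   slope-zero model. *)
pose kX : {poly K} := (slope f)%:P * 'X.
have kX0 : kX`_0 = 0 by rewrite coef0M coefX mulr0.
have kX1 : kX`_1 = slope f by rewrite coefCM coefX mulr1.
pose x := E (0, kX, kX); pose y := E (kX, 0, kX).
pose e1 := E (1, 0, 0); pose e3 := E (0, 0, 1).
have bx : model zero_ideal x.
  exists (0, kX, kX); split => //; rewrite /diag0 /zero_ideal /slope /= coef0 ?kX0 //.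
  by rewrite add0r subrr.
have by_ : model zero_ideal y.
  exists (kX, 0, kX); split => //; rewrite /diag0 /zero_ideal /slope /= coef0 ?kX0 //.
  by rewrite addr0 subrr.
have ye : y = e1 * y + e3 * x.
  rewrite -!rmorphM -rmorphD; congr (E _).
  by apply: triple_eq; rewrite /= ?mul1r ?mul0r ?add0r ?addr0.
have xe1 : e1 * x = 0.
  rewrite -rmorphM -(rmorph0 E); congr (E _).
  by apply: triple_eq; rewrite /= ?mul1r ?mul0r.
have ie1 := iE (1, 0, 0); have ie3 := iE (0, 0, 1); rewrite -/e1 -/e3 in ie1 ie3.
have rhoP : phi (e1 * y) 1 = phi 1 (e1 * y).
  have i13 : intclos (model zero_ideal) (e1 * y) by rewrite -rmorphM.
  have i33 : intclos (model zero_ideal) (e3 * x) by rewrite -rmorphM.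
  (* Both sides meet in the middle: y = e1 y + e3 x, and the cross terms vanish once x is moved onto
     e1. *)
  transitivity (phi (e1 * y) e1).
    rewrite (bal y e1 1) // mulr1 [in LHS]ye addr //.
    rewrite [e3 * x]mulrC -(bal x e1 e3) // xe1 phi0l // addr0.
    by rewrite [in LHS](mulrC e1 y) -(bal y e1 e1).
  rewrite [in RHS]mulrC -(bal y 1 e1) // mul1r [in RHS]ye addl //.
  by rewrite (bal x e3 e1) // [x * e1]mulrC xe1 phi0r // addr0.
pose g := f - (kX, 0, 0).
have bg : model zero_ideal (E g).
  exists g; split => //.
    by apply: diag0B => //; split; rewrite /= ?kX0 ?coef0.
  by rewrite /g /zero_ideal slopeB {2}/slope /= coef0 kX1 addr0 subr0 subrr.
have -> : E f = E g + e1 * y.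
  rewrite -rmorphM -rmorphD; congr (E _).
  by apply: triple_eq; rewrite /g /= ?mul1r ?mul0r ?subrK ?subr0 ?addr0.
have i13 : intclos (model zero_ideal) (e1 * y) by rewrite -rmorphM.
by rewrite addl // addr // rhoP -[E g in LHS]mul1r bal // mulr1.
Qed.

(* Condition under which model I is weakly Arf: it only matters for
   denominators vanishing at t = 0. *)
Definition slope_arf (I : K -> Prop) :=
  forall a1 a2 a3 u1 u2 u3 v1 v2 v3 : K,
    I (a1 + a2 - a3) -> I (a1 * u1 + a2 * u2 - a3 * u3) ->
    I (a1 * v1 + a2 * v2 - a3 * v3) ->
    I (a1 * (u1 * v1) + a2 * (u2 * v2) - a3 * (u3 * v3)).

(** If a(0) = 0, the slope of a u is the combination of the a_i'(0) u_i(0) and [slope_arf] applies.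
    Otherwise u and v themselves have a common value at t = 0 and the derivation rule concludes. *)
Lemma weakly_arf_triple (I : K -> Prop) (a u v : triple K) :
  is_ideal I -> slope_arf I ->
  diag0 a -> I (slope a) -> diag0 (a * u) -> I (slope (a * u)) ->
  diag0 (a * v) -> I (slope (a * v)) ->
  diag0 (a * (u * v)) /\ I (slope (a * (u * v))).
Proof.
move=> [I0 ID IM] W [a12 a13] Ia [] + + Iu [] + + Iv.
rewrite /= !coef0M -a12 -a13 => u12 u13 v12 v13.
have [a0|a0] := eqVneq (a.1.1`_0) 0.
  split; first by split; rewrite /= !coef0M -?a12 -?a13 a0 !mul0r.
  move: Ia Iu Iv; rewrite /slope /= !coef1M -a12 -a13 a0 !mul0r !add0r !coef0M.
  exact: W.
(* As a(0) need not be invertible, only a(0) slope(u) and a(0) slope(v) are known to lie in I; the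
   slope of a u v is built from these and slope(a). *)
have IB p q : I (p + q) -> I p -> I q.
  move=> Ipq Ip; have -> : q = (p + q) + (-1) * p by ring.
  by apply: ID => //; apply: IM.
have da : diag0 a by [].
have du : diag0 u by split; apply: (mulfI a0).
have dv : diag0 v by split; apply: (mulfI a0).
move: Iu Iv; rewrite !slopeM //; last exact: diag0M.
rewrite ![_ + _ * slope a]addrC => Iu Iv.
split; first by apply: diag0M => //; apply: diag0M.
have {Iu} Iu := IB _ _ Iu (IM _ _ Ia); have {Iv} Iv := IB _ _ Iv (IM _ _ Ia).
apply: (ID); first exact: IM.
have -> : a.1.1`_0 * (u.1.1`_0 * slope v + v.1.1`_0 * slope u) =
  u.1.1`_0 * (a.1.1`_0 * slope v) + v.1.1`_0 * (a.1.1`_0 * slope u) by ring.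
by apply: ID; apply: IM.
Qed.

Lemma adjoin_base (B S : Q -> Prop) q : B q -> adjoin B S q.
Proof. by move=> Bq T _ BT _; exact: BT. Qed.

Lemma arf_iter_base (B : Q -> Prop) n q : B q -> arf_iter n B q.
Proof. by move=> Bq; elim: n => // n IHn; apply: adjoin_base. Qed.

(** By induction the iterate sits between the slope-zero model and [model I], so b / a and c / a are
    triples u, v and b c / a = a u v is covered by the statement on triples. *)
Lemma arf_iter_model (I : K -> Prop) n q : is_ideal I -> slope_arf I ->
  arf_iter n (model zero_ideal) q -> model I q.
Proof.
move=> iI W; elim: n q => [|n IHn] q; first by apply: modelS; case: iI.
apply; first exact: model_subring.
  exact: IHn.
move=> _ [a [b [c [nza Bb Bc [ub vc ->]]]]].
have low q' : model zero_ideal q' -> arf_iter n (model zero_ideal) q'.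
  exact: arf_iter_base.
have upp q' : arf_iter n (model zero_ideal) q' -> image q'.
  by move=> /IHn; apply: model_image.
have ua := nzd_is_unit low upp nza.
have /(intclos_image low upp) [u Eu] := ub.
have /(intclos_image low upp) [v Ev] := vc.
have [/IHn [fa [da Ia Ea]] _] := nza.
have Eb : b = E (fa * u) by rewrite rmorphM -Ea -Eu mulrC divrK.
have Ec : c = E (fa * v) by rewrite rmorphM -Ea -Ev mulrC divrK.
have [fb [db Ib]] := IHn _ Bb; rewrite Eb => /Einj eb; rewrite -eb in db Ib.
have [fc [dc Ic]] := IHn _ Bc; rewrite Ec => /Einj ec; rewrite -ec in dc Ic.
have [d I'] := weakly_arf_triple iI W da Ia db Ib dc Ic.
exists (fa * (u * v)); split => //.
by apply: (canLR (mulrK ua)); rewrite !rmorphM -Ea; ring.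
Qed.

End Model.
(** * Presenting the model by polynomial rings *)

HB.instance Definition _ (K : idomainType) :=
  GRing.isZmodMorphism.Build {poly K} (triple K) (@diagC K)
    (fun _ _ => erefl).
HB.instance Definition _ (K : idomainType) :=
  GRing.isMonoidMorphism.Build {poly K} (triple K) (@diagC K)
    (conj erefl (fun _ _ => erefl)).

Section Generators.
Variables (n : nat) (k : idomainType) (K : idomainType).
Notation U := {mpoly k[n]}.

Lemma mpoly_gen_ind (P : U -> Prop) :
  (forall c, P c%:MP) -> (forall i, P 'X_i) ->
  (forall p q, P p -> P q -> P (p + q)) ->
  (forall p q, P p -> P q -> P (p * q)) -> forall p, P p.
Proof.
move=> Pc PX PD PM; have P1 : P 1 by rewrite -mpolyC1.
elim/mpolyind => [|c m p _ _ Pp]; first by rewrite -mpolyC0.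
apply: (PD) => //; rewrite -mul_mpolyC; apply: (PM) => //.
rewrite mpolyXE_id; apply: big_ind => // i _.
by elim: (m i) => [|j IHj]; rewrite ?expr0 // exprS; apply: PM.
Qed.

Lemma mpoly_rmorph_eq (S : comNzRingType) (f g : {rmorphism U -> S}) :
  (forall c, f c%:MP = g c%:MP) -> (forall i, f 'X_i = g 'X_i) -> f =1 g.
Proof.
move=> Hc HX; apply: mpoly_gen_ind => // p q Hp Hq.
  by rewrite !rmorphD Hp Hq.
by rewrite !rmorphM Hp Hq.
Qed.

(** [gam] places the coefficient ring in U, which is generated by its image with [X] and [Y]. This
    covers k[X,Y] with K = k and k[X,Y,Z] with K = k[Z]. *)
Variables (h : {rmorphism U -> triple K}) (gam : {rmorphism K -> U}) (X Y : U).
Hypothesis hgam : forall c, h (gam c) = diagC c%:P.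
Hypothesis hX : h X = (0, 'X, 'X).
Hypothesis hY : h Y = ('X, 0, 'X).
Hypothesis gamC : forall c : k, exists d, c%:MP = gam d.
Hypothesis gamX : forall i : 'I_n, 'X_i = X \/ 'X_i = Y \/ exists d, 'X_i = gam d.

Lemma h_eval (r : {poly K}) (w : U) :
  h (map_poly gam r).[w] =
  (r \Po (h w).1.1, r \Po (h w).1.2, r \Po (h w).2).
Proof.
elim/poly_ind: r => [|r c IHr].
  by rewrite rmorph0 horner0 rmorph0 !comp_poly0.
rewrite rmorphD rmorphM /= map_polyX map_polyC hornerMXaddC rmorphD rmorphM /=.
by rewrite IHr hgam !comp_polyD !comp_polyM !comp_polyX !comp_polyC.
Qed.

(** Evaluation at w lifts a component back to U, and modulo m every p equals the lift of its image,
    as checked on generators; hence the kernel of the component lies in (m). *)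
Lemma eval_cong (pr : {rmorphism triple K -> {poly K}}) (w m : U) :
  (forall c, pr (diagC c%:P) = c%:P) ->
  (exists q, X - (map_poly gam (pr (h X))).[w] = m * q) ->
  (exists q, Y - (map_poly gam (pr (h Y))).[w] = m * q) ->
  forall p, pr (h p) = 0 -> exists q, p = m * q.
Proof.
move=> prC PX PY p hp0.
suff [q Hq] : exists q, p - (map_poly gam (pr (h p))).[w] = m * q.
  by exists q; rewrite -Hq hp0 rmorph0 horner0 subr0.
have Pgam d : exists q, gam d - (map_poly gam (pr (h (gam d)))).[w] = m * q.
  by exists 0; rewrite hgam prC map_polyC hornerC subrr mulr0.
elim/mpoly_gen_ind: p {hp0} => [c|i|p q [a Ha] [b Hb]|p q [a Ha] [b Hb]].
- by have [d ->] := gamC c.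
- by have [->|[->|[d ->]]] := gamX i.
- by exists (a + b); rewrite !rmorphD hornerD mulrDr -Ha -Hb; ring.
- exists (a * q + (map_poly gam (pr (h p))).[w] * b).
  rewrite !rmorphM hornerM mulrDr mulrA -Ha mulrCA -Hb; ring.
Qed.

Lemma comp1_eq0 p : (h p).1.1 = 0 -> exists q, p = X * q.
Proof.
apply: (@eval_cong (fst \o fst) Y) => //=; rewrite ?hX ?hY /=.
  by exists 1; rewrite rmorph0 horner0 subr0 mulr1.
by exists 0; rewrite map_polyX hornerX subrr mulr0.
Qed.

Lemma comp2_eq0 p : (h p).1.2 = 0 -> exists q, p = Y * q.
Proof.
apply: (@eval_cong (snd \o fst) X) => //=; rewrite ?hX ?hY /=.
  by exists 0; rewrite map_polyX hornerX subrr mulr0.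
by exists 1; rewrite rmorph0 horner0 subr0 mulr1.
Qed.

Lemma comp3_eq0 p : (h p).2 = 0 -> exists q, p = (X - Y) * q.
Proof.
apply: (@eval_cong snd X) => //=; rewrite ?hX ?hY /=.
  by exists 0; rewrite map_polyX hornerX subrr mulr0.
by exists (-1); rewrite map_polyX hornerX; ring.
Qed.

(** The factors are peeled off in turn: after dividing by X the quotient still vanishes in
    components 2 and 3, where X is the regular element t, and then likewise for Y in component 3. *)
Lemma h_eq0 p : h p = 0 -> exists q, p = q * (X * Y * (X - Y)).
Proof.
have polyX_reg (r : {poly K}) : 'X * r = 0 -> r = 0.
  by move/eqP; rewrite mulf_eq0 polyX_eq0 /= => /eqP.
move=> h0; have [|q1 e1] := @comp1_eq0 p; first by rewrite h0.
have h0' : (0, 'X, 'X) * h q1 = 0 by rewrite -hX -rmorphM -e1.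
have h12 : (h q1).1.2 = 0.
  exact: polyX_reg (congr1 (fun u : triple K => u.1.2) h0').
have h13 : (h q1).2 = 0.
  exact: polyX_reg (congr1 (fun u : triple K => u.2) h0').
have [q2 e2] := comp2_eq0 h12.
have [|q3 e3] := @comp3_eq0 q2.
  by apply: polyX_reg; rewrite -h13 e2 rmorphM hY.
by exists q3; rewrite e1 e2 e3; ring.
Qed.

Lemma h_onto1 r : exists p, (h p).1.1 = r.
Proof. by exists (map_poly gam r).[Y]; rewrite h_eval hY /= comp_polyXr. Qed.

Lemma h_onto2 r : exists p, (h p).1.2 = r.
Proof. by exists (map_poly gam r).[X]; rewrite h_eval hX /= comp_polyXr. Qed.

Lemma h_onto3 r : exists p, (h p).2 = r.
Proof. by exists (map_poly gam r).[X]; rewrite h_eval hX /= comp_polyXr. Qed.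

Lemma poly_split2 (r : {poly K}) :
  r = (r`_0)%:P + (r`_1)%:P * 'X + drop_poly 2 r * 'X^2.
Proof.
apply/polyP => i; rewrite !coefD coefC coefMX coefMXn coef_drop_poly coefC.
by case: i => [|[|i]] //=; rewrite ?addr0 ?add0r // !subSS subn0 addn2.
Qed.

Lemma h_image f : zero_ideal (slope f) -> diag0 f -> exists p, h p = f.
Proof.
move=> /eqP; rewrite subr_eq0 => /eqP slf [d12 d13].
(* Constants and slopes come from [gam], X and Y; Y(Y - X), X(X - Y) and XY map to t^2 in a single
   component each and carry the remaining terms. *)
exists (gam f.1.1`_0 + gam f.1.2`_1 * X + gam f.1.1`_1 * Y +
   (map_poly gam (drop_poly 2 f.1.1)).[Y] * (Y * (Y - X)) +
   (map_poly gam (drop_poly 2 f.1.2)).[X] * (X * (X - Y)) +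
   (map_poly gam (drop_poly 2 f.2)).[X] * (X * Y)).
rewrite !(rmorphD, rmorphN, rmorphM) /= !h_eval !hgam hX hY /=.
apply: triple_eq; rewrite /= !comp_polyXr.
- by rewrite [RHS]poly_split2; ring.
- by rewrite [RHS]poly_split2 -d12; ring.
- by rewrite [RHS]poly_split2 -d13 -slf polyCD; ring.
Qed.

Lemma diag0_h p : diag0 (h p) /\ zero_ideal (slope (h p)).
Proof.
have Pgam d : diag0 (h (gam d)) /\ zero_ideal (slope (h (gam d))).
  by rewrite hgam; split => //; apply: slope_diagC_polyC.
elim/mpoly_gen_ind: p => [c|i|p q [dp sp] [dq sq]|p q [dp sp] [dq sq]].
- by have [d ->] := gamC c.
- have [->|[->|[d ->]]] := gamX i => //.
    rewrite hX; split; first by rewrite /diag0 /= !coefX coef0.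
    by rewrite /zero_ideal /slope /= !coefX coef0 add0r subrr.
  rewrite hY; split; first by rewrite /diag0 /= !coefX coef0.
  by rewrite /zero_ideal /slope /= !coefX coef0 addr0 subrr.
- rewrite rmorphD; split; first exact: diag0D.
  by rewrite slopeD sp sq; apply: addr0.
- rewrite rmorphM; split; first exact: diag0M.
  by rewrite slopeM // sp sq !mulr0; apply: addr0.
Qed.

Lemma rangeE (Q : comUnitRingType) (E : {rmorphism triple K -> Q}) :
  seteq (model E (@zero_ideal K)) (fun q => exists p, q = E (h p)).
Proof.
move=> q; split=> [[f [df sf ->]]|[p ->]].
  by have [p <-] := h_image sf df; exists p.
by have [dp sp] := diag0_h p; exists (h p).
Qed.

End Generators.

(** * Morphisms out of presented rings *)

Lemma rmorphism_of (A B : comNzRingType) (f : A -> B) :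
  (forall a b, f (a - b) = f a - f b) -> f 1 = 1 ->
  (forall a b, f (a * b) = f a * f b) ->
  exists F : {rmorphism A -> B}, F =1 f.
Proof.
move=> fB f1 fM.
pose mB := GRing.isZmodMorphism.Build A B f fB.
pose mM := GRing.isMonoidMorphism.Build A B f (conj f1 fM).
pose F : {rmorphism A -> B} := HB.pack f mB mM.
by exists F.
Qed.

(** Used to identify quotients such as R/xR, known only through a presentation by U, with a
    polynomial ring in t. *)
Lemma quotient_iso (U B W : comNzRingType) (p : {rmorphism U -> B})
    (h : {rmorphism U -> W}) :
  (forall b, exists u, p u = b) -> (forall w, exists u, h u = w) ->
  (forall u, p u = 0 <-> h u = 0) ->
  exists F : {rmorphism B -> W},
    [/\ forall u, F (p u) = h u, injective F & forall w, exists b, F b = w].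
Proof.
move=> p_onto h_onto Hker; pose s b := epsilon (inhabits 0) (fun u => p u = b).
have sK b : p (s b) = b.
  exact: (epsilon_spec (inhabits 0) (fun u => p u = b) (p_onto b)).
have E u v : p u = p v -> h u = h v.
  move=> e; apply/eqP; rewrite -subr_eq0 -rmorphB; apply/eqP/Hker.
  by rewrite rmorphB e subrr.
have [|||F HF] := @rmorphism_of B W (h \o s).
- by move=> a b; rewrite /= -rmorphB; apply: E; rewrite rmorphB !sK.
- by rewrite /= -(rmorph1 h); apply: E; rewrite rmorph1 !sK.
- by move=> a b; rewrite /= -rmorphM; apply: E; rewrite rmorphM !sK.
have Fp u : F (p u) = h u by rewrite HF; apply: E; rewrite sK.
exists F; split=> // [b c|w]; last by have [u <-] := h_onto w; exists (p u).
have [[u <-] [v <-]] := (p_onto b, p_onto c); rewrite !Fp => e.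
apply/eqP; rewrite -subr_eq0 -rmorphB; apply/eqP/Hker.
by rewrite rmorphB e subrr.
Qed.

Lemma triple_rmorphism (A1 A2 A3 B1 B2 B3 : comNzRingType)
    (f1 : {rmorphism A1 -> B1}) (f2 : {rmorphism A2 -> B2})
    (f3 : {rmorphism A3 -> B3}) :
  exists F : {rmorphism (A1 * A2 * A3)%type -> (B1 * B2 * B3)%type},
    forall u, F u = (f1 u.1.1, f2 u.1.2, f3 u.2).
Proof.
apply: rmorphism_of => [[[a b] c] [[a' b'] c']||[[a b] c] [[a' b'] c']] /=.
- by rewrite !rmorphB.
- by rewrite !rmorph1.
- by rewrite !rmorphM.
Qed.

(* t^2 times any triple lies in the image of h, so E f is defined by
   pi (lift (t^2 f)) / pi (lift t^2). *)
Lemma triple_embedding (U : comNzRingType) (K : idomainType)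
    (Q : comUnitRingType) (h : {rmorphism U -> triple K})
    (pi : {rmorphism U -> Q}) :
  (forall p, pi p = 0 <-> h p = 0) ->
  (forall f, zero_ideal (slope f) -> diag0 f -> exists p, h p = f) ->
  (forall s, nzd (fun q => exists p, q = pi p) s -> s \is a GRing.unit) ->
  exists E : {rmorphism triple K -> Q},
    [/\ injective E,
        (forall f : triple K, f.1.1 != 0 -> f.1.2 != 0 -> f.2 != 0 ->
           E f \is a GRing.unit) &
        (forall p, E (h p) = pi p)].
Proof.
move=> Hker him Hunit.
have hE p q : h p = h q -> pi p = pi q.
  move=> e; apply/eqP; rewrite -subr_eq0 -rmorphB; apply/eqP/Hker.
  by rewrite rmorphB e subrr.
have Eh p q : pi p = pi q -> h p = h q.
  move=> e; apply/eqP; rewrite -subr_eq0 -rmorphB; apply/eqP/Hker.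
  by rewrite rmorphB e subrr.
have mul_eq0 (r s : {poly K}) : r != 0 -> r * s = 0 -> s = 0.
  by move=> r0 /eqP; rewrite mulf_eq0 (negbTE r0) /= => /eqP.
have piU p : (h p).1.1 != 0 -> (h p).1.2 != 0 -> (h p).2 != 0 ->
    pi p \is a GRing.unit.
  move=> h1 h2 h3; apply: Hunit; split; first by exists p.
  move=> _ [q ->]; rewrite -rmorphM => /Hker; rewrite rmorphM => e; apply/Hker.
  apply: triple_eq.
  - exact: mul_eq0 h1 (congr1 (fun u : triple K => u.1.1) e).
  - exact: mul_eq0 h2 (congr1 (fun u : triple K => u.1.2) e).
  - exact: mul_eq0 h3 (congr1 (fun u : triple K => u.2) e).
pose X2 : triple K := diagC 'X^2.
have X20 : ('X^2 : {poly K}) != 0 by rewrite expf_neq0 // polyX_eq0.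
pose L f := epsilon (inhabits 0) (fun p => h p = X2 * f).
have hL f : h (L f) = X2 * f.
  apply: (epsilon_spec (inhabits 0) (fun p => h p = X2 * f)); apply: him.
    exact: slope_X2.
  exact: diag0_X2.
pose d := pi (L 1).
have du : d \is a GRing.unit by apply: piU; rewrite hL /= mulr1.
have [|||E HE] := @rmorphism_of (triple K) Q (fun f => pi (L f) / d).
- move=> f g; rewrite -mulrBl -rmorphB; congr (_ / _); apply: hE.
  by rewrite rmorphB !hL mulrBr.
- by rewrite divrr.
- move=> f g; apply: (canLR (mulrK du)); apply: (mulIr du).
  have -> : pi (L f) / d * (pi (L g) / d) * d * d = pi (L f) * pi (L g).
    transitivity (pi (L f) / d * d * (pi (L g) / d * d)); first by ring.
    by rewrite !divrK.
  by rewrite -!rmorphM; apply: hE; rewrite !rmorphM !hL; ring.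
exists E; split.
- move=> f g; rewrite !HE => /(divIr du)/Eh; rewrite !hL => e.
  have mul_inj (r s : {poly K}) : 'X^2 * r = 'X^2 * s -> r = s by apply: mulfI.
  apply: triple_eq; apply: mul_inj.
  + exact: (congr1 (fun u : triple K => u.1.1) e).
  + exact: (congr1 (fun u : triple K => u.1.2) e).
  + exact: (congr1 (fun u : triple K => u.2) e).
- move=> f f1 f2 f3; rewrite HE unitrM unitrV du andbT.
  by apply: piU; rewrite hL /= mulf_neq0.
- move=> p; rewrite HE; apply: (canLR (mulrK du)).
  by rewrite -rmorphM; apply: hE; rewrite rmorphM !hL mulr1 mulrC.
Qed.

(** Turns pointwise equivalence into equality, so that rings can be rewritten inside the closure
    operators. *)
Lemma seteq_eq (Q : Type) (P1 P2 : Q -> Prop) : seteq P1 P2 -> P1 = P2.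
Proof.
by move=> H; apply: functional_extensionality => q; apply: propositional_extensionality.
Qed.

(** * Splitting off the multiples of rho *)

Section ModelDecomposition.
Variables (K : idomainType) (Q : comUnitRingType).
Variable E : {rmorphism triple K -> Q}.
Implicit Types (I : K -> Prop) (c : K).

Lemma model_diagC c : model E (@zero_ideal K) (E (diagC c%:P)).
Proof. by exists (diagC c%:P); split => //; apply: slope_diagC_polyC. Qed.

Lemma slope_CX c : slope (diagC c%:P * ('X, 0, 0)) = c.
Proof.
by rewrite /slope /= !mulr0 coef0 !coefCM coefX mulr1 addr0 subr0.
Qed.

Lemma diag0_CX c : diag0 (diagC c%:P * ('X, 0, 0)).
Proof. by split; rewrite /= !mulr0 coef0 coefCM coefX mulr0. Qed.

(** The triple (t, 0, 0), which is rho, vanishes at t = 0 and has slope 1; subtracting slope(f) rho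
    from f leaves slope 0. *)
Lemma model_decomp I q : model E I q <->
  exists r c, [/\ model E (@zero_ideal K) r, I c &
                  q = r + E (diagC c%:P) * E ('X, 0, 0)].
Proof.
split.
  move=> [f [df If ->]].
  exists (E (f - diagC (slope f)%:P * ('X, 0, 0))), (slope f); split => //.
    exists (f - diagC (slope f)%:P * ('X, 0, 0)); split => //.
      by apply: diag0B => //; apply: diag0_CX.
    by rewrite /zero_ideal slopeB slope_CX subrr.
  by rewrite -rmorphM -rmorphD subrK.
move=> [r [c [[f [df sf ->]] Ic ->]]].
exists (f + diagC c%:P * ('X, 0, 0)); split.
- by apply: diag0D => //; apply: diag0_CX.
- by rewrite slopeD slope_CX sf add0r.
- by rewrite rmorphD rmorphM.
Qed.

(** A multiple c rho is y (c, 0, 0), already in y D^3; conversely x u + y v vanishes at t = 0 in all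
    components. *)
Lemma model_top_max_ideal q : model E (fun _ => True) q <->
  exists a u v, [/\ model E (@zero_ideal K) a, image E u, image E v &
                    q = a + E (0, 'X, 'X) * u + E ('X, 0, 'X) * v].
Proof.
split.
  move=> /model_decomp [r [c [Hr _ ->]]].
  exists r, (E 0), (E (c%:P, 0, 0)); split => //; [by exists 0 | by eexists |].
  rewrite rmorph0 mulr0 addr0 -!rmorphM; congr (_ + E _).
  by apply: triple_eq; rewrite /= ?mulr0 ?mul0r // mulrC.
move=> [_ [_ [_ [[f [df sf ->]] [u ->] [v ->] ->]]]].
exists (f + (0, 'X, 'X) * u + ('X, 0, 'X) * v); split => //.
  apply: diag0D; first apply: diag0D => //.
    by split; rewrite /= !coef0M !coefX ?coef0 !mul0r.
  by split; rewrite /= !coef0M !coefX ?coef0 !mul0r.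
by rewrite !rmorphD !rmorphM.
Qed.

Hypothesis Einj : injective E.

Lemma model_zero_CX I c :
  model E I (E (diagC c%:P) * E ('X, 0, 0)) <-> I c.
Proof.
rewrite -rmorphM; split=> [[f [_ If]]|Ic].
  by move=> /Einj e; rewrite -e slope_CX in If.
by exists (diagC c%:P * ('X, 0, 0)); split; rewrite ?slope_CX //; apply: diag0_CX.
Qed.

End ModelDecomposition.

(** * The slope condition over F_2 and over k[z] *)

Lemma F2P (a : 'F_2) : a = 0 \/ a = 1.
Proof.
by case: a => [[|[|m]] Hm]; [left; apply: val_inj | right; apply: val_inj |].
Qed.

Lemma addF2 (a : 'F_2) : a + a = 0.
Proof. by have [->|->] := F2P a; apply/eqP. Qed.

(** Unless all slopes are 0, exactly two of them are 1, and each hypothesis says that the two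
    corresponding values agree. *)
Lemma slope_arf_F2 : slope_arf (@zero_ideal 'F_2).
Proof.
move=> a1 a2 a3 u1 u2 u3 v1 v2 v3; rewrite /zero_ideal.
move=> /eqP; rewrite subr_eq0 => /eqP <-.
have [->|->] := F2P a1; have [->|->] := F2P a2.
- by rewrite addr0 !mul0r addr0 subr0.
- rewrite !add0r !mul0r !add0r !mul1r.
  by move=> /eqP; rewrite subr_eq0 => /eqP -> /eqP; rewrite subr_eq0 => /eqP ->; rewrite subrr.
- rewrite !addr0 !mul0r !addr0 !mul1r.
  by move=> /eqP; rewrite subr_eq0 => /eqP -> /eqP; rewrite subr_eq0 => /eqP ->; rewrite subrr.
- rewrite addF2 !mul1r !mul0r !subr0.
  move=> /eqP; rewrite addr_eq0 => /eqP -> /eqP; rewrite addr_eq0 => /eqP ->.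
  by rewrite mulrNN addF2.
Qed.

(** The ideal (z(1 + z)), written as the kernel of evaluation at both points of F_2 so that the
    condition can be checked pointwise. *)
Definition vanish01 (c : {poly 'F_2}) := c.[0] = 0 /\ c.[1] = 0.

Lemma is_ideal_vanish01 : is_ideal vanish01.
Proof.
split=> [|a b [a0 a1] [b0 b1]|c a [a0 a1]]; split.
1,2: by rewrite horner0.
1,2: by rewrite hornerD ?a0 ?a1 ?b0 ?b1 addr0.
1,2: by rewrite hornerM ?a0 ?a1 mulr0.
Qed.

Lemma slope_arf_vanish01 : slope_arf vanish01.
Proof.
move=> a1 a2 a3 u1 u2 u3 v1 v2 v3 [A0 A1] [U0 U1] [V0 V1].
have ev (p q r : {poly 'F_2}) x : (p + q - r).[x] = p.[x] + q.[x] - r.[x].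
  by rewrite hornerD hornerN hornerD.
rewrite !ev !hornerM in A0 A1 U0 U1 V0 V1.
by split; rewrite ev !hornerM; [exact: (slope_arf_F2 A0 U0 V0) | exact: (slope_arf_F2 A1 U1 V1)].
Qed.

Lemma vanish01P c : vanish01 c <-> exists g, c = g * ('X * (1 + 'X)).
Proof.
split; last first.
  have h1 (x : 'F_2) : (1 + 'X).[x] = 1 + x by rewrite hornerD hornerX -polyC1 hornerC.
  by move=> [g ->]; split; rewrite !hornerM hornerX h1 ?addF2 ?mul0r !mulr0.
move=> [/rootP c0 /rootP c1].
have /factor_theorem [g Hg] := c0.
have c1' : root g 1.
  by move/rootP: c1; rewrite Hg polyC0 subr0 hornerM hornerX mulr1 => c1; apply/rootP.
have /factor_theorem [g' Hg'] := c1'; exists g'.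
rewrite Hg Hg' polyC0 subr0 polyC1 -mulrA [_ * 'X]mulrC; congr (_ * (_ * _)).
by rewrite addrC; congr (_ + _); rewrite -polyC1 -polyCN; congr (_%:P); apply: val_inj.
Qed.

(** * The length of A*/A *)

Section Length.
Variables (Q : comUnitRingType) (E : {rmorphism triple 'F_2 -> Q}).
Hypothesis Einj : injective E.
Let A := model E (@zero_ideal 'F_2).
Let Astar := model E (fun _ => True).

Lemma A_strict_Astar : strict_sub A Astar.
Proof.
split=> [q|]; first exact: modelS.
exists (E (diagC 1%:P) * E ('X, 0, 0)); split; first exact/model_zero_CX.
by move=> /(model_zero_CX Einj) /eqP; rewrite oner_eq0.
Qed.

Lemma submod_subring (B C : Q -> Prop) :
  subring C -> (forall q, B q -> C q) -> submod B C.
Proof.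
move=> sC BC; split; first exact: subring0.
  by move=> *; apply: subringD.
by move=> b u /BC Cb Cu; apply: subringM.
Qed.

(** A submodule strictly above A contains some r + c rho with c nonzero, so c = 1 and rho itself
    belongs to it; it is then all of A*. *)
Lemma length_Astar : length_quot A Astar A 1.
Proof.
have sA : subring A by apply: model_subring; apply: is_ideal_zero.
have sT : subring Astar by apply: model_subring.
have [AT neA] := A_strict_Astar.
split.
  exists (fun i => if i is 0%N then A else Astar); split=> // [[|i] _|[|i] //].
  - exact: submod_subring.
  - exact: submod_subring.
move=> m [L [L0 Lm Lmod Lstrict]]; rewrite leqNgt; apply/negP => lt1m.
have Lmono i : (i <= m)%N -> forall q, L i q -> Astar q.
  move=> le_im q; move: (subnK le_im); move: (m - i)%N => d.
  elim: d i le_im => [|d IHd] i le_im.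
    by rewrite add0n => ->; apply: (proj1 (Lm q)).
  move=> e Lq; have lt_im : (i < m)%N by rewrite -e addSn ltnS leq_addl.
  apply: (IHd i.+1) => //; first by rewrite addnS.
  by have [H _] := Lstrict i lt_im; apply: H.
have m0 := ltnW lt1m.
have [L01 [q [L1q nL0q]]] := Lstrict 0%N m0.
have [_ [q' [L2q' nL1q']]] := Lstrict 1%N lt1m.
apply: nL1q'; have /model_decomp [r [c [Ar _ ->]]] := Lmono 2 lt1m _ L2q'.
have [_ L1D L1M] := Lmod 1%N m0.
have AL1 a : A a -> L 1%N a by move=> Aa; apply/L01/(proj2 (L0 a)).
apply: (L1D); first exact: AL1.
apply: L1M; first exact: model_diagC.
have /model_decomp [r1 [c1 [Ar1 _ eq]]] := Lmono 1%N m0 _ L1q.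
have ec : c1 = 1.
  have [c10|//] := F2P c1; case: nL0q; apply/L0.
  by rewrite eq c10 polyC0 rmorph0 mul0r addr0.
have -> : E ('X, 0, 0) = q + (0 - r1).
  by rewrite eq ec polyC1 rmorph1 mul1r; ring.
apply: L1D => //; apply: AL1; apply: subringB => //; exact: subring0.
Qed.

End Length.
(** * The rings A and R *)

(** Two indeterminates are both written ['X]: the outer one is t, the inner one, in ['X%:P], is
    z. *)
Definition genR (i : 'I_3) : triple {poly 'F_2} :=
  if val i == 0%N then (0, 'X, 'X) else
  if val i == 1%N then ('X, 0, 'X) else diagC 'X%:P.

Definition genA (i : 'I_2) : triple 'F_2 :=
  if val i == 0%N then (0, 'X, 'X) else ('X, 0, 'X).

Definition hR : {rmorphism {mpoly 'F_2[3]} -> triple {poly 'F_2}} :=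
  mmap (@diagC {poly 'F_2} \o (polyC \o polyC)) genR.

Definition hA : {rmorphism {mpoly 'F_2[2]} -> triple 'F_2} :=
  mmap (@diagC 'F_2 \o polyC) genA.

Lemma gamR_exists : exists gam : {rmorphism {poly 'F_2} -> {mpoly 'F_2[3]}},
  forall g, gam g = (map_poly (@mpolyC 3 'F_2) g).['X_iZ].
Proof.
apply: rmorphism_of => [f g||f g].
- by rewrite rmorphB hornerD hornerN.
- by rewrite rmorph1 -polyC1 hornerC.
- by rewrite rmorphM hornerM.
Qed.

Lemma hR_C c : hR c%:MP = diagC c%:P%:P. Proof. exact: mmapC. Qed.
Lemma hR_X i : hR 'X_i = genR i.
Proof. by rewrite [LHS]mmapX mmap1U. Qed.
Lemma hA_C c : hA c%:MP = diagC c%:P. Proof. exact: mmapC. Qed.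
Lemma hA_X i : hA 'X_i = genA i.
Proof. by rewrite [LHS]mmapX mmap1U. Qed.

Lemma ord3P (i : 'I_3) : [\/ i = iX, i = iY | i = iZ].
Proof.
case: i => [[|[|[|m]]] Hm] //.
- by constructor 1; apply: val_inj.
- by constructor 2; apply: val_inj.
- by constructor 3; apply: val_inj.
Qed.

Notation jX := (@Ordinal 2 0 isT).
Notation jY := (@Ordinal 2 1 isT).

Lemma ord2P (i : 'I_2) : i = jX \/ i = jY.
Proof.
case: i => [[|[|m]] Hm] //.
- by left; apply: val_inj.
- by right; apply: val_inj.
Qed.

Lemma hR_gam (gam : {rmorphism {poly 'F_2} -> {mpoly 'F_2[3]}}) :
  (forall g, gam g = (map_poly (@mpolyC 3 'F_2) g).['X_iZ]) ->
  [/\ forall c, hR (gam c) = diagC c%:P,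
      forall c : 'F_2, exists d, c%:MP = gam d &
      forall i : 'I_3, ('X_i : {mpoly 'F_2[3]}) = 'X_iX \/
        ('X_i : {mpoly 'F_2[3]}) = 'X_iY \/ exists d, 'X_i = gam d].
Proof.
move=> Hg; split.
- move=> g; elim/poly_ind: g => [|g c IHg]; first by rewrite !rmorph0.
  rewrite !rmorphD !rmorphM /= IHg; congr (_ * _ + _).
    by rewrite Hg map_polyX hornerX hR_X.
  by rewrite Hg map_polyC hornerC hR_C.
- by move=> c; exists c%:P; rewrite Hg map_polyC hornerC.
- move=> i; have [->|->|->] := ord3P i; [by left | by right; left |].
  by right; right; exists 'X; rewrite Hg map_polyX hornerX.
Qed.

Lemma hA_gam :
  [/\ forall c, hA c%:MP = diagC c%:P,
      forall c : 'F_2, exists d : 'F_2, c%:MP_[2] = d%:MP &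
      forall i : 'I_2, ('X_i : {mpoly 'F_2[2]}) = 'X_(jX) \/
        ('X_i : {mpoly 'F_2[2]}) = 'X_(jY) \/ exists d : 'F_2, 'X_i = d%:MP_[2]].
Proof.
split; [exact: hA_C | by move=> c; exists c |].
by move=> i; have [->|->] := ord2P i; [left | right; left].
Qed.

(** Characteristic 2 turns the factor X - Y of the general model into the X + Y of the theorem. *)
Lemma mpolyF2_opp n (p : {mpoly 'F_2[n]}) : - p = p.
Proof.
apply/eqP; rewrite eq_sym -addr_eq0; apply/eqP.
by apply/mpolyP => m; rewrite mcoeffD mcoeff0 addF2.
Qed.

Lemma polyF2_opp (p : {poly 'F_2}) : - p = p.
Proof.
apply/eqP; rewrite eq_sym -addr_eq0; apply/eqP.
by apply/polyP => m; rewrite coefD coef0 addF2.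
Qed.

Lemma hR_eq0 p : hR p = 0 <-> exists q, p = q * fXYXY.
Proof.
have [gam Hg] := gamR_exists; have [g1 g2 g3] := hR_gam Hg.
split.
  move=> /(h_eq0 g1 (hR_X iX) (hR_X iY) g2 g3) [q ->]; exists q.
  by rewrite mpolyF2_opp.
move=> [q ->]; rewrite rmorphM -[RHS](mulr0 (hR q)); congr (_ * _).
rewrite /fXYXY !rmorphM rmorphD !hR_X /genR /=; apply: triple_eq.
- by rewrite /= !mul0r.
- by rewrite /= mulr0 mul0r.
- rewrite /= (_ : 'X + 'X = 0) ?mulr0 //.
  by apply/polyP => i; rewrite coefD coef0 -{1}['X`_i]polyF2_opp addNr.
Qed.

(** The inclusion of k[t]^3 in k[z][t]^3, that is, of the integral closure of A in that of R. *)
Definition jmap (f : triple 'F_2) : triple {poly 'F_2} :=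
  (map_poly polyC f.1.1, map_poly polyC f.1.2, map_poly polyC f.2).

Lemma jmapB f g : jmap (f - g) = jmap f - jmap g.
Proof. by rewrite /jmap !rmorphB. Qed.
Lemma jmap1 : jmap 1 = 1.
Proof. by rewrite /jmap !rmorph1. Qed.
Lemma jmapM f g : jmap (f * g) = jmap f * jmap g.
Proof. by rewrite /jmap !rmorphM. Qed.

HB.instance Definition _ := GRing.isZmodMorphism.Build _ _ jmap jmapB.
HB.instance Definition _ := GRing.isMonoidMorphism.Build _ _ jmap (conj jmap1 jmapM).

Lemma jmap_inj : injective jmap.
Proof.
move=> f g [e1 e2 e3].
by apply: triple_eq; apply: (map_inj_poly (@polyC_inj _)).
Qed.

Lemma incl2_rmorph : exists F : {rmorphism {mpoly 'F_2[2]} -> {mpoly 'F_2[3]}},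
  [/\ forall p, incl2 p = F p, forall c, F c%:MP = c%:MP,
      F 'X_(jX) = 'X_iX & F 'X_(jY) = 'X_iY].
Proof.
exists (mmap (@mpolyC 3 'F_2) (fun i : 'I_2 => 'X_(widen_ord (isT : (2 <= 3)%N) i))).
split=> //= [c||]; first exact: mmapC.
- by rewrite mmapX mmap1U; congr 'X_(_); apply: val_inj.
- by rewrite mmapX mmap1U; congr 'X_(_); apply: val_inj.
Qed.

Lemma jmap_hA p : jmap (hA p) = hR (incl2 p).
Proof.
have [F [HF FC FX FY]] := incl2_rmorph; rewrite HF.
apply: (mpoly_rmorph_eq (f := jmap \o hA) (g := hR \o F)) => [c|i] /=.
  by rewrite hA_C FC hR_C /jmap /= map_polyC.
have [->|->] := ord2P i; rewrite hA_X ?FX ?FY hR_X /jmap /=.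
  by rewrite map_polyX rmorph0.
by rewrite map_polyX rmorph0.
Qed.

Lemma jmap_components p1 p2 p3 :
  jmap ((hA p1).1.1, (hA p2).1.2, (hA p3).2) =
  ((hR (incl2 p1)).1.1, (hR (incl2 p2)).1.2, (hR (incl2 p3)).2).
Proof.
rewrite [LHS]/jmap.
have e1 : map_poly polyC (hA p1).1.1 = (hR (incl2 p1)).1.1 by rewrite -jmap_hA.
have e2 : map_poly polyC (hA p2).1.2 = (hR (incl2 p2)).1.2 by rewrite -jmap_hA.
have e3 : map_poly polyC (hA p3).2 = (hR (incl2 p3)).2 by rewrite -jmap_hA.
by rewrite -e1 -e2 -e3.
Qed.

(** * A and R inside one total ring of fractions *)

Section Embedded.
Variables (Q : comUnitRingType) (pi : {rmorphism {mpoly 'F_2[3]} -> Q}).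
Variable E : {rmorphism triple {poly 'F_2} -> Q}.
Hypothesis Einj : injective E.
Hypothesis Eunit : forall f : triple {poly 'F_2},
  f.1.1 != 0 -> f.1.2 != 0 -> f.2 != 0 -> E f \is a GRing.unit.
Hypothesis EhR : forall p, E (hR p) = pi p.

(** A is studied inside the total ring of fractions of R; [intclos] only admits fractions with
    numerator and denominator in A. *)
Definition EA : {rmorphism triple 'F_2 -> Q} := E \o jmap.

Lemma EA_inj : injective EA.
Proof. by move=> f g /Einj/jmap_inj. Qed.

Lemma EA_unit f :
  f.1.1 != 0 -> f.1.2 != 0 -> f.2 != 0 -> EA f \is a GRing.unit.
Proof.
have nz (p : {poly 'F_2}) : p != 0 -> map_poly (@polyC 'F_2) p != 0.
  apply: contra_neq => e; apply: (map_inj_poly (@polyC_inj 'F_2)) => //.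
  by rewrite rmorph0.
by move=> f1 f2 f3; apply: Eunit; apply: nz.
Qed.

Lemma EA_hA p : EA (hA p) = pi (incl2 p).
Proof. by rewrite /EA /= jmap_hA. Qed.

Lemma EA_components p1 p2 p3 :
  EA ((hA p1).1.1, (hA p2).1.2, (hA p3).2) =
  E ((hR (incl2 p1)).1.1, (hR (incl2 p2)).1.2, (hR (incl2 p3)).2).
Proof. exact: (congr1 E (jmap_components p1 p2 p3)). Qed.

Lemma EA_diagC c : EA (diagC c%:P) = E (diagC c%:P%:P).
Proof. by rewrite /EA /= /jmap /= map_polyC. Qed.

Lemma EA_X00 : EA ('X, 0, 0) = E ('X, 0, 0).
Proof. by rewrite /EA /= /jmap /= map_polyX rmorph0. Qed.

Lemma xxE : xx pi = E (0, 'X, 'X).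
Proof. by rewrite /xx -EhR hR_X. Qed.

Lemma yyE : yy pi = E ('X, 0, 'X).
Proof. by rewrite /yy -EhR hR_X. Qed.

Lemma zzE : zz pi = E (diagC 'X%:P).
Proof. by rewrite /zz -EhR hR_X. Qed.

Lemma xxEA : xx pi = EA (0, 'X, 'X).
Proof. by rewrite xxE /EA /= /jmap /= map_polyX rmorph0. Qed.

Lemma yyEA : yy pi = EA ('X, 0, 'X).
Proof. by rewrite yyE /EA /= /jmap /= map_polyX rmorph0. Qed.

Lemma kcE c : kc pi c = EA (diagC c%:P).
Proof. by rewrite /kc -EhR hR_C EA_diagC. Qed.

Lemma kzP q : kz pi q <-> exists g, q = E (diagC g%:P).
Proof.
have [gam Hg] := gamR_exists; have [g1 _ _] := hR_gam Hg.
by split=> -[g ->]; exists g; rewrite -g1 Hg EhR.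
Qed.

Lemma Rr_model : Rr pi = model E (@zero_ideal _).
Proof.
have [gam Hg] := gamR_exists; have [g1 g2 g3] := hR_gam Hg.
apply: seteq_eq => q; apply: iff_trans (iff_sym (rangeE g1 (hR_X iX) (hR_X iY) g2 g3 _ _)).
by split=> -[p ->]; exists p.
Qed.

Lemma Ar_model : Ar pi = model EA (@zero_ideal _).
Proof.
have [g1 g2 g3] := hA_gam.
apply: seteq_eq => q.
apply: iff_trans (iff_sym (rangeE (gam := @mpolyC 2 'F_2) g1 (hA_X jX) (hA_X jY) g2 g3 _ _)).
by split=> -[p ->]; exists p; rewrite EA_hA.
Qed.

(** A subring containing A* and z contains k, x, y, z, hence R and k[z], and also rho, so the
    decomposition along rho gives everything. *)
Lemma Rstar_adjoin :
  seteq (model E (fun _ => True))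
        (adjoin (model EA (fun _ => True)) (fun q => q = zz pi)).
Proof.
move=> q; split.
  move=> /model_decomp [r [c [Rr0 _ ->]]] T sT AT zT.
  have sAT a : model EA (@zero_ideal _) a -> T a by move=> Ma; apply/AT/modelS.
  have RT p : T (pi p).
    elim/mpoly_gen_ind: p => [d|i|p p' Tp Tp'|p p' Tp Tp'].
    - by rewrite -/(kc pi d) kcE; apply/sAT/model_diagC.
    - have [->|->|->] := ord3P i; last exact: zT.
        by apply: sAT; rewrite -Ar_model; exists 'X_(jX); rewrite -EA_hA hA_X; apply: xxEA.
      by apply: sAT; rewrite -Ar_model; exists 'X_(jY); rewrite -EA_hA hA_X; apply: yyEA.
    - by rewrite rmorphD; apply: subringD.
    - by rewrite rmorphM; apply: subringM.
  have {}RT s : model E (@zero_ideal _) s -> T s by rewrite -Rr_model => -[p ->].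
  apply: subringD => //; first exact: RT.
  apply: subringM => //; first exact/RT/model_diagC.
  rewrite -EA_X00 -[EA _]mul1r -(rmorph1 EA); apply: AT.
  exact/(model_zero_CX EA_inj (fun _ => True) 1).
apply; first by apply: model_subring.
- move=> _ [f [[d1 d2] _ ->]]; exists (jmap f); split=> //.
  by split; rewrite /= !coef_map /= -?d1 -?d2.
- by move=> _ ->; rewrite zzE; apply: modelS => //; apply: model_diagC.
Qed.

(* With a = y + z x and b = z (y + x), the quotient b / a = (z, 1, 0) is
   integral and b^2 / a - b = z (1 + z) rho. *)
Lemma arf_closure_model :
  seteq (arf_closure (model E (@zero_ideal _))) (model E vanish01).
Proof.
have hK : almost_integrally_closed {poly {poly 'F_2}}.
  by do 2!apply: poly_almost_integrally_closed; apply: field_almost_integrally_closed.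
have sR : subring (model E (@zero_ideal {poly 'F_2})).
  by apply: model_subring; apply: is_ideal_zero.
move=> q; split.
  move=> [n]; apply: arf_iter_model => //; first exact: is_ideal_vanish01.
  exact: slope_arf_vanish01.
move=> /model_decomp [r [c [Mr /vanish01P [g ->] ->]]]; exists 1%N => /= T sT RT ST.
pose zX : {poly {poly 'F_2}} := 'X%:P * 'X.
(* The slopes 1, z, 1 + z satisfy the relation of R without any being zero, which cannot happen over
   F_2. *)
pose a := E ('X, zX, (1 + 'X)%:P * 'X).
pose b := E (zX, zX, 0).
pose u := E ('X%:P, 1, 0).
have zX0 : zX`_0 = 0 by rewrite coefCM coefX mulr0.
have zX1 : zX`_1 = 'X by rewrite coefCM coefX mulr1.
have ua : a \is a GRing.unit.
  apply: Eunit; rewrite /= ?mulf_neq0 ?polyC_eq0 ?polyX_eq0 //.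
  by apply/negP => /eqP /(congr1 (fun p : {poly 'F_2} => p`_1)); rewrite coefD coefX coef1 coef0.
have Ma : model E (@zero_ideal _) a.
  exists ('X, zX, (1 + 'X)%:P * 'X); split=> //.
    by split; rewrite /= ?zX0 ?coefCM !coefX ?mulr0.
  by rewrite /zero_ideal /slope /= zX1 coefCM coefX mulr1 subrr.
have Mb : model E (@zero_ideal _) b.
  exists (zX, zX, 0); split=> //; first by split; rewrite //= coef0.
  by rewrite /zero_ideal /slope /= zX1 coef0 subr0 -{1}['X]polyF2_opp addNr.
have ba : b / a = u.
  apply: (canLR (mulrK ua)); rewrite -rmorphM; congr (E _).
  by apply: triple_eq; [| rewrite [RHS]mul1r | rewrite [RHS]mul0r].
have Ib : intclos (model E (@zero_ideal _)) (b / a).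
  have low q' : model E (@zero_ideal _) q' -> model E (@zero_ideal _) q' by [].
  apply/(intclos_image Einj Eunit hK low (@model_image _ _ E _)).
  by rewrite ba; exists ('X%:P, 1, 0).
have Tb : T (b * b / a).
  apply: ST; exists a, b, b; split=> //; split=> // s _ H.
  by rewrite -[s](mulKr ua) H mulr0.
have e : E (diagC ('X * (1 + 'X))%:P) * E ('X, 0, 0) = b * b / a - b.
  rewrite -mulrA ba -!rmorphM -rmorphB; congr (E _); apply: triple_eq => /=.
  - have -> : 'X * (1 + 'X) = 'X * 'X - 'X :> {poly 'F_2} by rewrite polyF2_opp; ring.
    by rewrite /zX polyCB polyCM; ring.
  - by rewrite mulr0 mulr1 subrr.
  - by rewrite !mulr0 subr0.
apply: subringD => //; first exact: RT.
have -> : diagC (g * ('X * (1 + 'X)))%:P = diagC g%:P * diagC ('X * (1 + 'X))%:P.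
  by rewrite -!rmorphM.
rewrite rmorphM -mulrA e.
apply: subringM => //; first exact/RT/model_diagC.
by apply: subringB => //; apply: RT.
Qed.

Lemma arf_closure_A :
  seteq (arf_closure (model EA (@zero_ideal _))) (model EA (@zero_ideal _)).
Proof.
move=> q; split; last by exists 0%N.
move=> [n]; apply: arf_iter_model.
- exact: EA_inj.
- exact: EA_unit.
- by apply: poly_almost_integrally_closed; apply: field_almost_integrally_closed.
- exact: is_ideal_zero.
- exact: slope_arf_F2.
Qed.

End Embedded.

(** * Products of quotients and the theorem *)

Lemma addF2XX : 'X + 'X = 0 :> {poly {poly 'F_2}}.
Proof. by apply/polyP => i; rewrite coefD coef0 -{1}['X`_i]polyF2_opp addNr. Qed.

(** Translates divisibility by x, y or x + y in the ring, as in the presentations of the theorem,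
    into the vanishing of one component. *)
Lemma component_kernel (U : comNzRingType) (K : idomainType) (Q : comUnitRingType)
    (E : {rmorphism triple K -> Q}) (h : {rmorphism U -> triple K}) (P : U -> Q)
    (pr : {rmorphism triple K -> {poly K}}) (m : U) (mQ : Q) :
  injective E -> (forall p, E (h p) = P p) -> E (h m) = mQ -> pr (h m) = 0 ->
  (forall p, pr (h p) = 0 -> exists q, p = m * q) ->
  forall p, (exists q, P p = mQ * P q) <-> pr (h p) = 0.
Proof.
move=> Einj EP <- prm prP p; split=> [[q]|/prP [q ->]].
  by rewrite -!EP -rmorphM => /Einj ->; rewrite rmorphM prm mul0r.
by exists q; rewrite -!EP -rmorphM -rmorphM.
Qed.

Lemma triple_presentation (U A1 A2 A3 : comNzRingType) (K : idomainType)
    (Q : comUnitRingType) (E : {rmorphism triple K -> Q})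
    (h : {rmorphism U -> triple K}) (p1 : {rmorphism U -> A1})
    (p2 : {rmorphism U -> A2}) (p3 : {rmorphism U -> A3}) :
  injective E ->
  (forall r, exists u, (h u).1.1 = r) -> (forall r, exists u, (h u).1.2 = r) ->
  (forall r, exists u, (h u).2 = r) ->
  (forall b, exists u, p1 u = b) -> (forall b, exists u, p2 u = b) ->
  (forall b, exists u, p3 u = b) ->
  (forall u, p1 u = 0 <-> (h u).1.1 = 0) ->
  (forall u, p2 u = 0 <-> (h u).1.2 = 0) ->
  (forall u, p3 u = 0 <-> (h u).2 = 0) ->
  exists psi : {rmorphism (A1 * A2 * A3)%type -> Q},
    [/\ injective psi, seteq (image E) (fun q => exists u, q = psi u) &
        forall u1 u2 u3, psi (p1 u1, p2 u2, p3 u3) =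
                         E ((h u1).1.1, (h u2).1.2, (h u3).2)].
Proof.
move=> Einj h1 h2 h3 o1 o2 o3 k1 k2 k3.
have [F1 [F1E F1i F1o]] := quotient_iso (h := (fst \o fst) \o h) o1 h1 k1.
have [F2 [F2E F2i F2o]] := quotient_iso (h := (snd \o fst) \o h) o2 h2 k2.
have [F3 [F3E F3i F3o]] := quotient_iso (h := snd \o h) o3 h3 k3.
have [F HF] := triple_rmorphism F1 F2 F3.
exists (E \o F); split=> [[[a b] c] [[a' b'] c'] /Einj|q|u1 u2 u3].
- by rewrite !HF => -[/F1i -> /F2i -> /F3i ->].
- split=> [[[[f1 f2] f3] ->]|[u ->]]; last by exists (F u).
  have [[a <-] [b <-] [c <-]] := And3 (F1o f1) (F2o f2) (F3o f3).
  by exists (a, b, c); rewrite /= HF.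
- by rewrite /= HF /= F1E F2E F3E.
Qed.

Unset Implicit Arguments.

Theorem theorem4p4
  (* R = U/(XY(X+Y)), realized as the image of pi : U -> Q, and Q = Q(R) *)
  (Q : comUnitRingType) (pi : {rmorphism {mpoly 'F_2[3]} -> Q})
  (Hker : forall p, pi p = 0 <-> exists q, p = q * fXYXY)
  (HQ : total_frac (Rr pi))
  (* presentations of R/xR, R/yR, R/(x+y)R as quotients of U *)
  (Rx Ry Rxy : comNzRingType)
  (px : {rmorphism {mpoly 'F_2[3]} -> Rx})
  (py : {rmorphism {mpoly 'F_2[3]} -> Ry})
  (pxy : {rmorphism {mpoly 'F_2[3]} -> Rxy})
  (Hpx : forall u, exists p, px p = u)
  (Hpy : forall u, exists p, py p = u)
  (Hpxy : forall u, exists p, pxy p = u)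
  (Hkx : forall p, px p = 0 <-> exists q, pi p = xx pi * pi q)
  (Hky : forall p, py p = 0 <-> exists q, pi p = yy pi * pi q)
  (Hkxy : forall p, pxy p = 0 <-> exists q, pi p = (xx pi + yy pi) * pi q)
  (* presentations of A/xA, A/yA, A/(x+y)A as quotients of k[X,Y] *)
  (Ax Ay Axy : comNzRingType)
  (qx : {rmorphism {mpoly 'F_2[2]} -> Ax})
  (qy : {rmorphism {mpoly 'F_2[2]} -> Ay})
  (qxy : {rmorphism {mpoly 'F_2[2]} -> Axy})
  (Hqx : forall u, exists p, qx p = u)
  (Hqy : forall u, exists p, qy p = u)
  (Hqxy : forall u, exists p, qxy p = u)
  (Hlx : forall p, qx p = 0 <-> exists q, pi (incl2 p) = xx pi * pi (incl2 q))
  (Hly : forall p, qy p = 0 <-> exists q, pi (incl2 p) = yy pi * pi (incl2 q))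
  (Hlxy : forall p, qxy p = 0 <->
            exists q, pi (incl2 p) = (xx pi + yy pi) * pi (incl2 q)) :
  exists (psi : {rmorphism (Rx * Ry * Rxy)%type -> Q})
         (psiA : {rmorphism (Ax * Ay * Axy)%type -> Q}),
  let R := Rr pi in
  let A := Ar pi in
  let x := xx pi in
  let y := yy pi in
  let z := zz pi in
  let rho := psiA (qx 'X_(@Ordinal 2 1 isT), 0, 0) in
  let Astar := strict_closure A (intclos A) in
  let Rstar := strict_closure R (intclos R) in
  (* (1) *)
  [/\ injective psi,
      seteq (intclos R) (fun q => exists u, q = psi u) &
      (forall p, psi (px p, py p, pxy p) = pi p)]
  /\
  [/\ injective psiA,
      seteq (intclos A) (fun q => exists u, q = psiA u),
      (forall p, psiA (qx p, qy p, qxy p) = pi (incl2 p)) &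
      (forall p1 p2 p3, psiA (qx p1, qy p2, qxy p3) =
                        psi (px (incl2 p1), py (incl2 p2), pxy (incl2 p3)))]
  /\
  (* (2) *)
  [/\ seteq Astar (fun q => exists a u v,
                    [/\ A a, intclos A u, intclos A v & q = a + x * u + y * v]),
      seteq Astar (fun q => exists a c, A a /\ q = a + kc pi c * rho) &
      length_quot A Astar A 1]
  /\
  (* (3) *)
  (seteq (arf_closure A) A /\ strict_sub A Astar)
  /\
  (* (4) *)
  [/\ seteq Rstar (adjoin Astar (fun q => q = z)),
      seteq Rstar (fun q => exists r g, [/\ R r, kz pi g & q = r + g * rho]),
      seteq (arf_closure R)
            (fun q => exists r g, [/\ R r, kz pi g & q = r + g * (z * (1 + z)) * rho]),
      strict_sub R (arf_closure R) &
      strict_sub (arf_closure R) Rstar].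
Proof.
have Hk p : pi p = 0 <-> hR p = 0.
  exact: iff_trans (Hker p) (iff_sym (hR_eq0 p)).
have [gam Hg] := gamR_exists; have [g1 g2 g3] := hR_gam Hg.
have [a1 a2 a3] := hA_gam.
have himg := h_image g1 (hR_X iX) (hR_X iY).
have [E [Einj Eunit EhR]] := triple_embedding Hk himg (proj1 HQ).
pose EAm := EA E.
have EAi : injective EAm := EA_inj Einj.
have EAu := EA_unit Eunit.
have hKA : almost_integrally_closed {poly 'F_2}.
  by apply: poly_almost_integrally_closed; apply: field_almost_integrally_closed.
have hKR : almost_integrally_closed {poly {poly 'F_2}}.
  exact: poly_almost_integrally_closed.
have xE := xxE EhR; have yE := yyE EhR.
have xA := xxEA EhR; have yA := yyEA EhR.
have [|||psi [psi_inj psi_im psiE]] :=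
  triple_presentation (p1 := px) (p2 := py) (p3 := pxy) Einj
    (h_onto1 g1 (hR_X iY)) (h_onto2 g1 (hR_X iX)) (h_onto3 g1 (hR_X iX))
    Hpx Hpy Hpxy.
- move=> p; apply: iff_trans (Hkx p) _.
  apply: (component_kernel (pr := fst \o fst) (m := 'X_iX) Einj EhR).
  + exact: EhR.
  + exact: (congr1 (fun u : triple _ => u.1.1) (hR_X iX)).
  + exact: (comp1_eq0 g1 (hR_X iX) (hR_X iY) g2 g3).
- move=> p; apply: iff_trans (Hky p) _.
  apply: (component_kernel (pr := snd \o fst) (m := 'X_iY) Einj EhR).
  + exact: EhR.
  + exact: (congr1 (fun u : triple _ => u.1.2) (hR_X iY)).
  + exact: (comp2_eq0 g1 (hR_X iX) (hR_X iY) g2 g3).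
- move=> p; apply: iff_trans (Hkxy p) _.
  apply: (component_kernel (pr := snd) (m := 'X_iX + 'X_iY) Einj EhR).
  + by rewrite EhR rmorphD.
  + by rewrite rmorphD !hR_X; exact: addF2XX.
  + rewrite -{1}['X_iY]mpolyF2_opp.
    exact: (comp3_eq0 g1 (hR_X iX) (hR_X iY) g2 g3).
have EAhA := EA_hA EhR.
have [|||psiA [psiA_inj psiA_im psiAE]] :=
  triple_presentation (p1 := qx) (p2 := qy) (p3 := qxy) EAi
    (h_onto1 (gam := @mpolyC 2 'F_2) a1 (hA_X jY))
    (h_onto2 (gam := @mpolyC 2 'F_2) a1 (hA_X jX))
    (h_onto3 (gam := @mpolyC 2 'F_2) a1 (hA_X jX))
    Hqx Hqy Hqxy.
- move=> p; apply: iff_trans (Hlx p) _.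
  apply: (component_kernel (pr := fst \o fst) (m := 'X_(jX)) EAi EAhA).
  + by rewrite hA_X xA.
  + exact: (congr1 (fun u : triple _ => u.1.1) (hA_X jX)).
  + exact: (comp1_eq0 (gam := @mpolyC 2 'F_2) a1 (hA_X jX) (hA_X jY) a2 a3).
- move=> p; apply: iff_trans (Hly p) _.
  apply: (component_kernel (pr := snd \o fst) (m := 'X_(jY)) EAi EAhA).
  + by rewrite hA_X yA.
  + exact: (congr1 (fun u : triple _ => u.1.2) (hA_X jY)).
  + exact: (comp2_eq0 (gam := @mpolyC 2 'F_2) a1 (hA_X jX) (hA_X jY) a2 a3).
- move=> p; apply: iff_trans (Hlxy p) _.
  apply: (component_kernel (pr := snd) (m := 'X_(jX) + 'X_(jY)) EAi EAhA).
  + by rewrite rmorphD !hA_X rmorphD xA yA.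
  + by rewrite rmorphD !hA_X /= -{1}['X]polyF2_opp addNr.
  + rewrite -{1}['X_(jY)]mpolyF2_opp.
    exact: (comp3_eq0 (gam := @mpolyC 2 'F_2) a1 (hA_X jX) (hA_X jY) a2 a3).
(* Modulo x the element y becomes t, so rho is the triple (t, 0, 0). *)
have rhoE : psiA (qx 'X_(jY), 0, 0) = E ('X, 0, 0).
  rewrite -(rmorph0 qy) -(rmorph0 qxy) psiAE !rmorph0 hA_X; exact: EA_X00.
have Rm := Rr_model EhR; have Am := Ar_model EhR.
have intR : intclos (Rr pi) = image E.
  apply: seteq_eq; rewrite Rm; apply: (intclos_image Einj Eunit hKR) => // q.
  exact: model_image.
have intA : intclos (Ar pi) = image EAm.
  apply: seteq_eq; rewrite Am; apply: (intclos_image EAi EAu hKA) => // q.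
  exact: model_image.
have starR : strict_closure (Rr pi) (intclos (Rr pi)) = model E (fun _ => True).
  by apply: seteq_eq; rewrite Rm; apply: strict_closure_model.
have starA : strict_closure (Ar pi) (intclos (Ar pi)) = model EAm (fun _ => True).
  by apply: seteq_eq; rewrite Am; apply: strict_closure_model.
have arfR : arf_closure (Rr pi) = model E vanish01.
  by apply: seteq_eq; rewrite Rm; apply: arf_closure_model.
have arfA : arf_closure (Ar pi) = Ar pi.
  by apply: seteq_eq; rewrite Am; apply: arf_closure_A.
have I01 := is_ideal_vanish01.
exists psi, psiA; cbv zeta; rewrite rhoE starA starR arfA arfR intA intR.
split; [split=> // | split; [split=> // | split; [split | split; [split | split]]]].
- by move=> p; rewrite psiE -EhR; congr (E _); apply: triple_eq.
- by move=> p; rewrite psiAE -EAhA; congr (EA E _); apply: triple_eq.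
- move=> p1 p2 p3; rewrite psiE.
  exact: etrans (psiAE p1 p2 p3) (EA_components E p1 p2 p3).
- by move=> q; rewrite Am xA yA; apply: model_top_max_ideal.
- move=> q; rewrite Am; apply: iff_trans (model_decomp _ _ _) _.
  split=> [[r [c [Mr _ ->]]]|[r [c [Mr ->]]]]; exists r, c.
    by rewrite (kcE EhR) -(EA_X00 E).
  by rewrite (kcE EhR) -(EA_X00 E).
- by rewrite Am; apply: length_Astar.
- by [].
- by rewrite Am; apply: A_strict_Astar.
- exact: Rstar_adjoin.
- move=> q; rewrite Rm; apply: iff_trans (model_decomp _ _ _) _.
  split=> [[r [c [Mr _ ->]]]|[r [g [Mr /(kzP EhR) [c ->] ->]]]].
    by exists r, (E (diagC c%:P)); split=> //; apply/(kzP EhR); exists c.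
  by exists r, c.
- move=> q; rewrite Rm; apply: iff_trans (model_decomp _ _ _) _.
  have zc (g : {poly 'F_2}) : E (diagC (g * ('X * (1 + 'X)))%:P) =
      E (diagC g%:P) * (zz pi * (1 + zz pi)).
    rewrite (zzE EhR) -(rmorph1 E) -rmorphD -!rmorphM; congr (E _).
    by apply: triple_eq; rewrite /= !polyCM polyCD polyC1.
  split=> [[r [c [Mr /vanish01P [g ->] ->]]]|[r [g [Mr /(kzP EhR) [c ->] ->]]]].
    exists r, (E (diagC g%:P)); split=> //; last by rewrite zc.
    by apply/(kzP EhR); exists g.
  exists r, (c * ('X * (1 + 'X))); split=> //; last by rewrite zc.
  by apply/vanish01P; exists c.
- rewrite Rm; split=> [q|]; first by apply: modelS; case: I01.
  (* z(1 + z) rho has the nonzero slope z(1 + z), hence lies outside R. *)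
  exists (E (diagC ('X * (1 + 'X))%:P) * E ('X, 0, 0)); split.
    by apply/(model_zero_CX Einj)/vanish01P; exists 1; rewrite mul1r.
  move=> /(model_zero_CX Einj) /eqP; apply/negP.
  rewrite mulf_neq0 ?polyX_eq0 //; apply/negP => /eqP.
  by move=> /(congr1 (fun p : {poly 'F_2} => p`_1)); rewrite coefD coefX coef1 coef0.
- split=> [q|].
    by move=> [f [df _ ->]]; exists f.
  (* rho has slope 1, which does not vanish at z = 0. *)
  exists (E (diagC 1%:P) * E ('X, 0, 0)); split.
    exact/(model_zero_CX Einj).
  move=> /(model_zero_CX Einj) [+ _]; rewrite -polyC1 hornerC => /eqP.
  by rewrite oner_eq0.
Qed.
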